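(* Let $\phi$ be a parabolic automorphism of the unit disk $\mathbb{D}$, let $\nu\in\mathbb{R}$ and $\lambda\in\mathbb{C}$. Then the operator $\lambda C_\phi$ is recurrent on $\mathcal{S}_\nu$ if and only if $\nu<1/2$ and $|\lambda|=1$.
   Context: $\mathbb{D}$ is the open unit disk of $\mathbb{C}$. For $\nu\in\mathbb{R}$, the weighted Dirichlet space $\mathcal{S}_\nu$ is the Hilbert space of analytic functions $f(z)=\sum_{n\ge 0}a_nz^n$ on $\mathbb{D}$ with $\|f\|_\nu^2=\sum_{n\ge0}|a_n|^2(n+1)^{2\nu}<\infty$. For a self-map $\phi$ of $\mathbb{D}$, $C_\phi f=f\circ\phi$; it is known that $C_\phi$ is bounded on every $\mathcal{S}_\nu$ when $\phi$ is a linear fractional self-map of $\mathbb{D}$. A bounded linear operator $T$ on a Hilbert space $\mathcal{H}$ is recurrent if for every non-empty open $U\subset\mathcal{H}$ there is a positive integer $n$ with $T^n(U)\cap U\neq\emptyset$. A linear fractional map ($\phi(z)=\frac{az+b}{cz+d}$, $ad-bc\ne0$) other than the identity is parabolic if it has only one fixed point in $\hat{\mathbb{C}}=\mathbb{C}\cup\{\infty\}$; for a self-map of $\mathbb{D}$ this fixed point lies on the unit circle. *)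

(* Defs.v *)
From Stdlib Require Import Reals.
From Coquelicot Require Import Coquelicot.

Open Scope R_scope.

Definition disk (z : C) : Prop := Cmod z < 1.

(* Functions on the disk are represented by total functions [C -> C] whose
   values outside [disk] are irrelevant: every notion below depends on the
   restriction to [disk] only. *)

Definition has_taylor (f : C -> C) (a : nat -> C) : Prop :=
  forall z : C, disk z ->
    @is_pseries C_AbsRing C_NormedModule a z (f z).

(* [is_norm nu f r]: f belongs to S_nu and its norm is r.  The sequence [a] is
   unique, by uniqueness of power series expansions. *)
Definition is_norm (nu : R) (f : C -> C) (r : R) : Prop :=
  0 <= r /\
  exists a : nat -> C,
    has_taylor f a /\
    is_series (fun n : nat => Cmod (a n) ^ 2 * Rpower (INR n + 1) (2 * nu))
      (r ^ 2).

Definition dirichlet (nu : R) (f : C -> C) : Prop :=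
  exists r : R, is_norm nu f r.

Definition dirichlet_open (nu : R) (U : (C -> C) -> Prop) : Prop :=
  (forall f, U f -> dirichlet nu f) /\
  (forall f, U f ->
     exists eps : R, 0 < eps /\
       forall (g : C -> C) (r : R),
         dirichlet nu g ->
         is_norm nu (fun z => (g z - f z)%C) r -> r < eps -> U g).

(* Boundedness of T on S_nu is not part of this predicate; for the operators
   [weighted_comp lambda phi] with phi linear fractional it is automatic. *)
Definition recurrent (nu : R) (T : (C -> C) -> (C -> C)) : Prop :=
  forall U : (C -> C) -> Prop,
    dirichlet_open nu U -> (exists f, U f) ->
    exists n : nat, (0 < n)%nat /\ exists f, U f /\ U (Nat.iter n T f).

Definition weighted_comp (lambda : C) (phi : C -> C) (f : C -> C) : C -> C :=
  fun z => (lambda * f (phi z))%C.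

(* The Riemann sphere; [None] is the point at infinity. *)
Definition sphere : Type := option C.

Definition mobius (a b c d : C) (w : sphere) : sphere :=
  match w with
  | None => if Ceq_dec c 0 then None else Some (a / c)%C
  | Some z =>
      if Ceq_dec (c * z + d)%C 0 then None
      else Some ((a * z + b) / (c * z + d))%C
  end.

Definition linear_fractional (m : sphere -> sphere) : Prop :=
  exists a b c d : C,
    (a * d - b * c)%C <> 0%C /\ forall w, m w = mobius a b c d w.

Definition parabolic (m : sphere -> sphere) : Prop :=
  linear_fractional m /\ (exists w, m w <> w) /\ (exists! w, m w = w).

Definition disk_automorphism (phi : C -> C) : Prop :=
  (forall z, disk z -> @ex_derive C_AbsRing C_NormedModule phi z) /\
  (forall z, disk z -> disk (phi z)) /\
  (forall z w, disk z -> disk w -> phi z = phi w -> z = w) /\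
  (forall w, disk w -> exists z, disk z /\ phi z = w).

Definition parabolic_automorphism (phi : C -> C) : Prop :=
  disk_automorphism phi /\
  exists m : sphere -> sphere,
    parabolic m /\ forall z, disk z -> m (Some z) = Some (phi z).

(* Main.v *)
Require Import Defs.
From Stdlib Require Import Reals Factorial Lra Lia.
From Coquelicot Require Import Coquelicot.
Open Scope R_scope.

(* Parabolic automorphisms are conjugate to translations.  If p is the fixed point,
   the coordinate s = 1 / (z - p) turns the map into s |-> s + k, and invariance of
   the disk forces |p| = 1 and k = i tau conj p with tau real and nonzero; so the
   iterates of phi form a piece of the one-parameter group [flow p T].

   Sufficiency.  Functions (1 - conj p z) / (1 - Q z) vanish at p, and their orbit
   under the flow tends to 0 in S_nu for nu < 1/2 as T -> +oo or -oo: their Dirichlet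
   seminorm is invariant while their low coefficients tend to 0.  Their span is dense,
   and for d in it d + T^-n d is close to d and is sent to T^n d + d by T^n.

   Necessity.  Point evaluations at phi_n(0) grow only polynomially in n, so near the
   constant 1 the factor lambda^n cannot grow or decay: |lambda| = 1.  For nu >= 1/2 the
   S_nu norm dominates the Dirichlet norm, so a small h satisfies
   |h(b) - h(a)| <= |b - a| |h| / (1 - rho^2) on the disk of radius rho; since
   |phi_n'(0)| = 1 / (1 + n^2 tau^2), no f near the identity function returns to it. *)

(** * Power series and the norm *)

(** The index 1/2 is where the weight (k+1)^(2 nu) becomes k+1, comparable to the weight k of the
    conformally invariant Dirichlet seminorm. Below it the weight is at most eps (k+1) + K for every
    eps > 0: the invariant part carries an arbitrarily small factor, and the rest is a multiple of
    the Hardy norm. No area integral appears. The functions z^k / (1 - Q z) have explicit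
    coefficients and explicit orbits, and invariance shows up as a cancellation between the factor
    1/m^2 picked up along the flow and the growth of the norm as |Q| tends to 1. Point evaluations
    and differences of values are treated dually, as functionals on coefficient sequences bounded by
    Cauchy-Schwarz on partial sums. *)

Notation Cseries := (@is_series C_AbsRing C_NormedModule).

Lemma has_taylorE (f : C -> C) (a : nat -> C) :
  has_taylor f a <->
  forall z, disk z -> Cseries (fun k => (a k * z ^ k)%C) (f z).
Proof.
  unfold has_taylor, is_pseries.
  split; intros H z Hz; specialize (H z Hz); revert H; apply is_series_ext; intros n;
    [change (z ^ n * a n = a n * z ^ n)%C | change (a n * z ^ n = z ^ n * a n)%C]; ring.
Qed.

Lemma Cseries_bound (c : nat -> C) (l : C) (B : R) :
  Cseries c l -> (forall n, sum_n (fun k => Cmod (c k)) n <= B) -> Cmod l <= B.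
Proof.
  intros H HB.
  assert (L : is_lim_seq (fun n => Cmod (sum_n (c : nat -> C_NormedModule) n)) (Cmod l)).
  { apply (filterlim_comp _ _ _ _ (fun x : C_NormedModule => Cmod x) _ _ _ H).
    apply (@filterlim_norm C_AbsRing C_NormedModule). }
  assert (E := is_lim_seq_le _ (fun _ => B) _ _
    (fun n => Rle_trans _ _ _ (@norm_sum_n_m C_AbsRing C_NormedModule c 0 n) (HB n)) L (is_lim_seq_const B)).
  exact E.
Qed.

Lemma Cseries_intro (c : nat -> C) (l : C) :
  is_lim_seq (fun n => Cmod (sum_n (c : nat -> C_NormedModule) n - l)) 0 -> Cseries c l.
Proof.
  intros H. apply (proj2 (@filterlim_locally_ball_norm C_AbsRing nat C_NormedModule eventually _ _ l)).
  intros eps. apply is_lim_seq_spec in H. destruct (H eps) as [N HN].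
  exists N. intros n Hn. specialize (HN n Hn). rewrite Rminus_0_r in HN.
  unfold ball_norm. eapply Rle_lt_trans; [apply Rle_abs|exact HN].
Qed.

Lemma sum_n_geom (z : C) (n : nat) :
  (sum_n (fun k => (z ^ k)%C : C_NormedModule) n * (1 - z) = 1 - z ^ S n)%C.
Proof.
  induction n as [|n IH].
  - rewrite sum_O. simpl. ring.
  - rewrite sum_Sn. unfold plus; simpl.
    rewrite Cmult_plus_distr_r, IH. simpl. ring.
Qed.

Lemma one_minus_neq_0 (z : C) : Cmod z < 1 -> (1 - z <> 0)%C.
Proof.
  intros H E. assert (z = 1%C) by (replace z with (1 - (1 - z))%C by ring; rewrite E; ring).
  subst z. rewrite Cmod_1 in H. lra.
Qed.

Lemma Cseries_geom (z : C) : Cmod z < 1 -> Cseries (fun k => (z ^ k)%C) (/ (1 - z))%C.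
Proof.
  intros H. pose proof (one_minus_neq_0 z H) as H1.
  apply Cseries_intro.
  apply is_lim_seq_ext with (fun n => (Cmod z * / Cmod (1 - z)%C) * Cmod z ^ n).
  - intros n.
    replace (sum_n (fun k => (z ^ k)%C : C_NormedModule) n - / (1 - z))%C
      with (- (z ^ S n * / (1 - z)))%C.
    + rewrite Cmod_opp, Cmod_mult, Cmod_inv, Cmod_pow by assumption. simpl. ring.
    + pose proof (sum_n_geom z n) as E.
      replace (sum_n (fun k => (z ^ k)%C : C_NormedModule) n) with ((1 - z ^ S n) / (1 - z))%C.
      * field. assumption.
      * rewrite <- E. field. assumption.
  - replace (Finite 0) with (Rbar_mult (Cmod z * / Cmod (1 - z)%C) 0) by (simpl; f_equal; ring).
    apply is_lim_seq_scal_l. apply is_lim_seq_geom.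
    rewrite Rabs_pos_eq; [assumption|apply Cmod_ge_0].
Qed.

Lemma Rsum_le_series (u : nat -> R) (S : R) (n : nat) :
  (forall k, 0 <= u k) -> is_series u S -> sum_n u n <= S.
Proof.
  intros Hu HS.
  apply (is_lim_seq_incr_compare (sum_n u)); [exact HS|].
  intros k. rewrite sum_Sn. unfold plus; simpl. specialize (Hu (Datatypes.S k)). lra.
Qed.

Lemma Rseries_ge0 (u : nat -> R) (S : R) :
  (forall k, 0 <= u k) -> is_series u S -> 0 <= S.
Proof.
  intros Hu HS. eapply Rle_trans; [|apply (Rsum_le_series u S 0 Hu HS)].
  rewrite sum_O. apply Hu.
Qed.

Lemma is_series_le (u v : nat -> R) (B : R) :
  (forall k, 0 <= u k <= v k) -> is_series v B ->
  exists A, is_series u A /\ 0 <= A <= B.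
Proof.
  intros H HB. exists (Series u).
  assert (E : ex_series u).
  { apply (@ex_series_le R_AbsRing R_CompleteNormedModule u v).
    - intros n. unfold norm; simpl; unfold abs; simpl. rewrite Rabs_pos_eq; apply H.
    - now exists B. }
  split; [now apply Series_correct|]. split.
  - apply (Rseries_ge0 u); [apply H|now apply Series_correct].
  - rewrite <- (is_series_unique v B HB). apply Series_le; [exact H|now exists B].
Qed.

Lemma Rseries_scal (c : R) (u : nat -> R) (S : R) :
  is_series u S -> is_series (fun k => c * u k) (c * S).
Proof. apply (@is_series_scal R_AbsRing R_NormedModule c u S). Qed.

Lemma Rseries_plus (u v : nat -> R) (A B : R) :
  is_series u A -> is_series v B -> is_series (fun k => u k + v k) (A + B).
Proof. apply (@is_series_plus R_AbsRing R_NormedModule u v A B). Qed.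

(** * Strict norm bounds *)

Definition weight (nu : R) (k : nat) : R := Rpower (INR k + 1) (2 * nu).

Definition sqnorm_series (nu : R) (a : nat -> C) (S : R) : Prop :=
  is_series (fun k => Cmod (a k) ^ 2 * weight nu k) S.

(** A strict bound on the squared norm, carried together with its coefficient sequence. Being an
    open condition free of square roots, it fits balls directly, and estimates only have to produce
    a summable majorant. *)
Definition norm_lt (nu : R) (f : C -> C) (rho : R) : Prop :=
  0 < rho /\ exists a S, has_taylor f a /\ sqnorm_series nu a S /\ S < rho ^ 2.

Lemma weight_gt0 nu k : 0 < weight nu k.
Proof. apply exp_pos. Qed.

Lemma sqnorm_term_ge0 nu (a : nat -> C) k : 0 <= Cmod (a k) ^ 2 * weight nu k.
Proof. apply Rmult_le_pos; [apply pow2_ge_0|apply Rlt_le, weight_gt0]. Qed.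

Lemma norm_ltE nu f rho : norm_lt nu f rho <-> exists r, is_norm nu f r /\ r < rho.
Proof.
  split.
  - intros [HR [a [S [Ha [HS HSR]]]]].
    assert (0 <= S) by (apply (Rseries_ge0 _ _ (sqnorm_term_ge0 nu a) HS)).
    exists (sqrt S). split.
    + split; [apply sqrt_pos|]. exists a. split; [assumption|]. rewrite pow2_sqrt; assumption.
    + rewrite <- (sqrt_pow2 rho) by lra. apply sqrt_lt_1_alt; lra.
  - intros [r [[Hr [a [Ha HS]]] HrR]]. split; [lra|].
    exists a, (r ^ 2). repeat split; try assumption. nra.
Qed.

Lemma dirichletE nu f : dirichlet nu f <-> exists rho, norm_lt nu f rho.
Proof.
  split.
  - intros [r Hr]. exists (r + 1). apply norm_ltE. exists r. split; [assumption|lra].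
  - intros [rho HR]. apply norm_ltE in HR. destruct HR as [r [Hr _]]. now exists r.
Qed.

Lemma has_taylor_ext f g a :
  (forall z, disk z -> f z = g z) -> has_taylor f a -> has_taylor g a.
Proof. intros E H z Hz. rewrite <- E by assumption. now apply H. Qed.

Lemma norm_lt_ext nu f g rho :
  (forall z, disk z -> f z = g z) -> norm_lt nu f rho -> norm_lt nu g rho.
Proof.
  intros E [HR [a [S [Ha H]]]]. split; [assumption|]. exists a, S.
  split; [now apply (has_taylor_ext f)|assumption].
Qed.

Lemma norm_lt_weaken nu f rho rho' : rho <= rho' -> norm_lt nu f rho -> norm_lt nu f rho'.
Proof.
  intros H [HR [a [S [Ha [HS HSR]]]]]. split; [lra|]. exists a, S.
  repeat split; try assumption. nra.
Qed.

Lemma has_taylor_plus f g a b :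
  has_taylor f a -> has_taylor g b ->
  has_taylor (fun z => f z + g z)%C (fun k => a k + b k)%C.
Proof.
  rewrite !has_taylorE. intros Ha Hb z Hz.
  eapply is_series_ext; [|apply (@is_series_plus C_AbsRing C_NormedModule _ _ _ _ (Ha z Hz) (Hb z Hz))].
  intros n. unfold plus; simpl. ring.
Qed.

Lemma has_taylor_scal f a c :
  has_taylor f a -> has_taylor (fun z => c * f z)%C (fun k => c * a k)%C.
Proof.
  rewrite !has_taylorE. intros Ha z Hz.
  eapply is_series_ext; [|apply (@is_series_scal C_AbsRing C_NormedModule c _ _ (Ha z Hz))].
  intros n. unfold scal; simpl; unfold mult; simpl. ring.
Qed.

(* The weighted Young inequality with ratio R2 / R1 yields the sharp triangle inequality. *)
Lemma norm_lt_plus nu f g R1 R2 :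
  norm_lt nu f R1 -> norm_lt nu g R2 -> norm_lt nu (fun z => f z + g z)%C (R1 + R2).
Proof.
  intros [HR1 [a [A [Ha [HA HA1]]]]] [HR2 [b [B [Hb [HB HB1]]]]]. split; [lra|].
  exists (fun k => a k + b k)%C.
  assert (HA0 := Rseries_ge0 _ _ (sqnorm_term_ge0 nu a) HA).
  assert (HB0 := Rseries_ge0 _ _ (sqnorm_term_ge0 nu b) HB).
  destruct (is_series_le (fun k => Cmod (a k + b k)%C ^ 2 * weight nu k)
    (fun k => (1 + R2 / R1) * (Cmod (a k) ^ 2 * weight nu k)
              + (1 + R1 / R2) * (Cmod (b k) ^ 2 * weight nu k))
    ((1 + R2 / R1) * A + (1 + R1 / R2) * B)) as [S [HS HS1]].
  - intros k. split; [apply (sqnorm_term_ge0 nu (fun k => (a k + b k)%C))|].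
    rewrite <- !Rmult_assoc, <- Rmult_plus_distr_r.
    apply Rmult_le_compat_r; [apply Rlt_le, weight_gt0|].
    apply Rle_trans with ((Cmod (a k) + Cmod (b k)) ^ 2).
    + apply pow_incr. split; [apply Cmod_ge_0|apply Cmod_triangle].
    + set (x := Cmod (a k)). set (y := Cmod (b k)).
      assert (E : (1 + R2 / R1) * x ^ 2 + (1 + R1 / R2) * y ^ 2 - (x + y) ^ 2
        = (R2 * x - R1 * y) ^ 2 / (R1 * R2)) by (field; lra).
      assert (0 <= (R2 * x - R1 * y) ^ 2 / (R1 * R2)).
      { apply Rdiv_le_0_compat; [apply pow2_ge_0|nra]. }
      lra.
  - apply Rseries_plus; apply Rseries_scal; assumption.
  - exists S. split; [now apply has_taylor_plus|]. split; [assumption|].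
    apply Rle_lt_trans with (1 := proj2 HS1).
    replace ((R1 + R2) ^ 2) with ((1 + R2 / R1) * R1 ^ 2 + (1 + R1 / R2) * R2 ^ 2) by (field; lra).
    assert (0 < R2 / R1) by (apply Rdiv_lt_0_compat; lra).
    assert (0 < R1 / R2) by (apply Rdiv_lt_0_compat; lra). nra.
Qed.

Lemma sqnorm_scal nu a c S :
  sqnorm_series nu a S -> sqnorm_series nu (fun k => c * a k)%C (Cmod c ^ 2 * S).
Proof.
  intros H. eapply is_series_ext; [|apply (Rseries_scal (Cmod c ^ 2) _ _ H)].
  intros k. rewrite Cmod_mult. simpl. ring.
Qed.

(** The target [rho'] is separate from |c| rho because [norm_lt] needs a positive radius, while c
    may be 0. *)
Lemma norm_lt_scal nu f c rho rho' :
  0 < rho' -> Cmod c * rho <= rho' -> norm_lt nu f rho -> norm_lt nu (fun z => c * f z)%C rho'.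
Proof.
  intros HR' Hc [HR [a [S [Ha [HS HSR]]]]]. split; [assumption|].
  exists (fun k => c * a k)%C, (Cmod c ^ 2 * S).
  split; [now apply has_taylor_scal|]. split; [now apply sqnorm_scal|].
  assert (HS0 := Rseries_ge0 _ _ (sqnorm_term_ge0 nu a) HS).
  destruct (Req_dec (Cmod c) 0) as [E|E].
  - rewrite E. nra.
  - pose proof (Cmod_ge_0 c).
    apply Rlt_le_trans with ((Cmod c * rho) ^ 2).
    + rewrite Rpow_mult_distr. apply Rmult_lt_compat_l; nra.
    + apply pow_incr. nra.
Qed.

Lemma norm_lt_opp nu f g rho :
  norm_lt nu (fun z => f z - g z)%C rho -> norm_lt nu (fun z => g z - f z)%C rho.
Proof.
  intros H. apply (norm_lt_ext nu (fun z => - (1) * (f z - g z))%C); [intros; ring|].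
  apply (norm_lt_scal nu _ _ rho); [apply H| |assumption].
  rewrite Cmod_m1. lra.
Qed.

Lemma norm_lt_minus_trans nu f g h R1 R2 :
  norm_lt nu (fun z => f z - g z)%C R1 -> norm_lt nu (fun z => g z - h z)%C R2 ->
  norm_lt nu (fun z => f z - h z)%C (R1 + R2).
Proof.
  intros H1 H2. eapply norm_lt_ext; [|apply (norm_lt_plus _ _ _ _ _ H1 H2)].
  intros z _. simpl. ring.
Qed.

Lemma norm_lt_0 nu (f : C -> C) rho : (forall z, disk z -> f z = 0%C) -> 0 < rho -> norm_lt nu f rho.
Proof.
  intros Hf HR. split; [assumption|]. exists (fun _ => RtoC 0), 0.
  split; [|split].
  - apply has_taylorE. intros z Hz. rewrite Hf by assumption.
    assert (H0 : Cmod 0 < 1) by (rewrite Cmod_0; lra).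
    assert (E : Cseries (fun k => RtoC 0 * RtoC 0 ^ k)%C (RtoC 0 * / (1 - 0))%C)
      by exact (@is_series_scal C_AbsRing C_NormedModule (RtoC 0) _ _ (Cseries_geom 0 H0)).
    rewrite Cmult_0_l in E. revert E. apply is_series_ext. intros k.
    change (RtoC 0 * RtoC 0 ^ k = RtoC 0 * z ^ k)%C. ring.
  - unfold sqnorm_series. generalize (Rseries_scal 0 _ _ (is_series_geom 0 ltac:(rewrite Rabs_R0; lra))).
    rewrite Rmult_0_l. apply is_series_ext. intros k. rewrite Cmod_0; simpl; ring.
  - nra.
Qed.

(** * Geometric functions *)

(** For nu < 1/2 the weight is o(k+1). The constant K is the threshold X with X^(1 - 2 nu) = 1 /
    eps: from X on, (k+1)^(2 nu - 1) is at most eps, and below X the weight is at most k + 1 < X. *)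
Lemma weight_le_linear nu eps : nu < 1 / 2 -> 0 < eps ->
  exists K, 0 <= K /\ forall k, weight nu k <= eps * (INR k + 1) + K.
Proof.
  intros Hnu He. exists (Rpower (/ eps) (/ (1 - 2 * nu))).
  split; [apply Rlt_le, exp_pos|]. intros k. unfold weight.
  set (X := Rpower (/ eps) (/ (1 - 2 * nu))). pose proof (pos_INR k) as Hk.
  assert (HX : 0 < X) by apply exp_pos.
  destruct (Rle_lt_dec X (INR k + 1)) as [H|H].
  - replace (2 * nu) with (1 + - (1 - 2 * nu)) by ring.
    rewrite Rpower_plus, Rpower_1, Rpower_Ropp by lra.
    assert (E : / eps <= Rpower (INR k + 1) (1 - 2 * nu)).
    { replace (/ eps) with (Rpower X (1 - 2 * nu)).
      - apply Rle_Rpower_l; lra.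
      - unfold X. rewrite Rpower_mult, Rinv_l, Rpower_1 by (try apply Rinv_0_lt_compat; lra).
        reflexivity. }
    assert (E2 : / Rpower (INR k + 1) (1 - 2 * nu) <= eps).
    { rewrite <- (Rinv_inv eps). apply Rinv_le_contravar; [now apply Rinv_0_lt_compat|assumption]. }
    nra.
  - apply Rle_trans with (INR k + 1); [|nra].
    rewrite <- (Rpower_1 (INR k + 1)) at 2 by lra. apply Rle_Rpower; lra.
Qed.

(** Cauchy square of the geometric series: degree n collects n + 1 equal products. *)
Lemma is_series_geom_derive (x : R) : 0 <= x < 1 ->
  is_series (fun k => (INR k + 1) * x ^ k) (/ (1 - x) ^ 2).
Proof.
  intros Hx. assert (H : Rabs x < 1) by (rewrite Rabs_pos_eq; lra).
  generalize (is_series_mult_pos _ _ _ _ (is_series_geom x H) (is_series_geom x H)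
    (fun n => pow_le x n (proj1 Hx)) (fun n => pow_le x n (proj1 Hx))).
  replace (/ (1 - x) ^ 2) with (/ (1 - x) * / (1 - x)) by (field; lra).
  apply is_series_ext. intros n.
  rewrite (sum_eq _ (fun _ => x ^ n)).
  - rewrite sum_cte, S_INR. simpl; ring.
  - intros i Hi. rewrite <- pow_add. f_equal. lia.
Qed.

Lemma is_series_shift (u : nat -> R) (k : nat) (S : R) :
  (forall j, (j < k)%nat -> u j = 0) -> is_series (fun j => u (k + j)%nat) S -> is_series u S.
Proof.
  intros H0 HS. destruct k as [|k]; [exact HS|].
  apply (is_series_decr_n u (Datatypes.S k)); [lia|].
  assert (E : S = plus S (opp (sum_n u (Init.Nat.pred (Datatypes.S k))))).
  { rewrite (sum_n_ext_loc u (fun _ => 0)) by (intros; apply H0; simpl in *; lia).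
    rewrite sum_n_const. change (S = S + - (INR (Datatypes.S k) * 0)). ring. }
  exact (eq_rect _ (fun l => is_series _ l) HS _ E).
Qed.

(** The case Q = 0 is the monomial z^k, and k = 1 is the shape met along orbits of the flow. *)
Definition mono_geom (k : nat) (Q z : C) : C := (z ^ k / (1 - Q * z))%C.

Lemma Cmod_mult_lt1 (Q z : C) : Cmod Q < 1 -> Cmod z < 1 -> Cmod (Q * z) < 1.
Proof.
  intros HQ Hz. rewrite Cmod_mult.
  pose proof (Cmod_ge_0 Q). pose proof (Cmod_ge_0 z). nra.
Qed.

Lemma has_taylor_mono_geom k Q : Cmod Q < 1 ->
  has_taylor (mono_geom k Q) (@PS_incr_n C_AbsRing C_NormedModule (fun j => (Q ^ j)%C) k).
Proof.
  intros HQ z Hz.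
  assert (H : @is_pseries C_AbsRing C_NormedModule (fun j => (Q ^ j)%C) z (/ (1 - Q * z))%C).
  { generalize (Cseries_geom _ (Cmod_mult_lt1 Q z HQ Hz)). apply is_series_ext. intros n.
    change ((Q * z) ^ n = z ^ n * Q ^ n)%C. rewrite Cpow_mult_l. ring. }
  exact (is_pseries_incr_n _ k _ _ H).
Qed.

(** The weight at k + j is at most eps (k+1)(j+1) + K, and both resulting series in |Q|^2 have
    closed sums. K depends on nu and eps only, so the bound stays usable while Q moves to the unit
    circle; the leading order (1 - |Q|^2)^-2 comes with the free factor eps. *)
Lemma norm_lt_mono_geom nu eps : nu < 1 / 2 -> 0 < eps ->
  exists K, 0 <= K /\ forall k Q rho, Cmod Q < 1 -> 0 < rho ->
    eps * (INR k + 1) / (1 - Cmod Q ^ 2) ^ 2 + K / (1 - Cmod Q ^ 2) < rho ^ 2 ->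
    norm_lt nu (mono_geom k Q) rho.
Proof.
  intros Hnu He. destruct (weight_le_linear nu eps Hnu He) as [K [HK HW]].
  exists K. split; [assumption|]. intros k Q rho HQ HR HB. split; [assumption|].
  exists (@PS_incr_n C_AbsRing C_NormedModule (fun j => (Q ^ j)%C) k).
  set (x := Cmod Q ^ 2) in *. pose proof (Cmod_ge_0 Q) as HQ0.
  assert (Hx : 0 <= x < 1) by (unfold x; split; nra).
  destruct (is_series_le (fun j => x ^ j * weight nu (k + j))
    (fun j => (eps * (INR k + 1)) * ((INR j + 1) * x ^ j) + K * x ^ j)
    ((eps * (INR k + 1)) * / (1 - x) ^ 2 + K * / (1 - x))) as [S [HS HSB]].
  - intros j. assert (0 <= x ^ j) by (apply pow_le; lra). split.
    + apply Rmult_le_pos; [assumption|apply Rlt_le, weight_gt0].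
    + apply Rle_trans with (x ^ j * (eps * (INR (k + j) + 1) + K)).
      * apply Rmult_le_compat_l; auto.
      * replace (eps * (INR k + 1) * ((INR j + 1) * x ^ j) + K * x ^ j)
          with (x ^ j * (eps * ((INR k + 1) * (INR j + 1)) + K)) by ring.
        rewrite plus_INR. pose proof (pos_INR k). pose proof (pos_INR j).
        apply Rmult_le_compat_l; [assumption|]. apply Rplus_le_compat_r.
        apply Rmult_le_compat_l; nra.
  - apply Rseries_plus; apply Rseries_scal.
    + now apply is_series_geom_derive.
    + apply is_series_geom. rewrite Rabs_pos_eq; lra.
  - exists S. split; [now apply has_taylor_mono_geom|]. split.
    + apply (is_series_shift _ k).
      * intros j Hj. rewrite PS_incr_n_simplify. destruct (Compare_dec.le_lt_dec k j); [lia|].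
        change (Cmod (RtoC 0) ^ 2 * weight nu j = 0). rewrite Cmod_0. ring.
      * revert HS. apply is_series_ext. intros j. rewrite PS_incr_n_simplify.
        destruct (Compare_dec.le_lt_dec k (k + j)) as [_|]; [|lia].
        replace (k + j - k)%nat with j by lia. rewrite Cmod_pow.
        unfold x. rewrite <- !pow_mult. now rewrite Nat.mul_comm.
    + eapply Rle_lt_trans; [apply HSB|exact HB].
Qed.

(** * The parabolic flow *)

Lemma conj_mul_self (p : C) : Cmod p = 1 -> (p * Cconj p = 1)%C.
Proof. intros H. rewrite <- Cmod2_conj, H. f_equal. ring. Qed.

(** Written in the rotated variable u = conj p z, whose fixed point is 1. It is the ratio of the new
    to the old coordinate 1 / (z - p), and 1 / [flow_den]^2 is the derivative of the flow. *)
Definition flow_den (p : C) (T : R) (z : C) : C := (1 + Ci * T * (Cconj p * z - 1))%C.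
Definition flow (p : C) (T : R) (z : C) : C := (p + (z - p) / flow_den p T z)%C.

(** The two moduli are those of the denominator and the numerator of conj p times the flow, with u =
    conj p z. The identity thus gives at once that the denominator has no zero in the disk and that
    the disk is preserved. *)
Lemma Cmod2_flow_den (T : R) (u : C) :
  Cmod (1 + Ci * T * (u - 1))%C ^ 2 - Cmod (1 + Ci * T * (u - 1) + (u - 1))%C ^ 2
  = 1 - Cmod u ^ 2.
Proof. rewrite !Cmod2_alt. destruct u as [x y]. simpl. ring. Qed.

Lemma Cmod_lt1_sq (z : C) : Cmod z < 1 <-> Cmod z ^ 2 < 1.
Proof. pose proof (Cmod_ge_0 z). split; intros; nra. Qed.

Lemma Cmod_sq_neq0 (z : C) : 0 < Cmod z ^ 2 -> z <> 0%C.
Proof. intros H E. rewrite E, Cmod_0 in H. lra. Qed.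

Section Flow.
Variable p : C.
Hypothesis Hp : Cmod p = 1.

Lemma Cmod_conj_mul z : Cmod (Cconj p * z)%C = Cmod z.
Proof. rewrite Cmod_mult, Cmod_conj, Hp. ring. Qed.

Lemma flow_den_gt0 T z : disk z -> 0 < Cmod (flow_den p T z) ^ 2.
Proof.
  intros Hz. unfold flow_den. pose proof (Cmod2_flow_den T (Cconj p * z)) as E.
  rewrite Cmod_conj_mul in E. apply Cmod_lt1_sq in Hz.
  pose proof (pow2_ge_0 (Cmod (1 + Ci * T * (Cconj p * z - 1) + (Cconj p * z - 1)))). lra.
Qed.

Lemma flow_den_neq0 T z : disk z -> flow_den p T z <> 0%C.
Proof. intros Hz. now apply Cmod_sq_neq0, flow_den_gt0. Qed.

Lemma minus_p z : (z - p = p * (Cconj p * z - 1))%C.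
Proof.
  replace (p * (Cconj p * z - 1))%C with (p * Cconj p * z - p)%C by ring.
  rewrite conj_mul_self by assumption. ring.
Qed.

Lemma conj_flow T z : disk z ->
  (Cconj p * flow p T z - 1 = (Cconj p * z - 1) / flow_den p T z)%C.
Proof.
  intros Hz. pose proof (flow_den_neq0 T z Hz) as Hd. unfold flow. rewrite minus_p.
  set (d := flow_den p T z) in *.
  replace (Cconj p * (p + p * (Cconj p * z - 1) / d) - 1)%C
    with (p * Cconj p * (1 + (Cconj p * z - 1) / d) - 1)%C by (field; assumption).
  rewrite conj_mul_self by assumption. field; assumption.
Qed.

Lemma Cmod2_flow T z : disk z ->
  1 - Cmod (flow p T z) ^ 2 = (1 - Cmod z ^ 2) / Cmod (flow_den p T z) ^ 2.
Proof.
  intros Hz. pose proof (flow_den_neq0 T z Hz) as Hd. pose proof (flow_den_gt0 T z Hz) as Hd2.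
  assert (E : Cmod (flow p T z) ^ 2
    = Cmod (flow_den p T z + (Cconj p * z - 1))%C ^ 2 / Cmod (flow_den p T z) ^ 2).
  { rewrite <- Cmod_conj_mul.
    replace (Cconj p * flow p T z)%C with ((Cconj p * flow p T z - 1) + 1)%C by ring.
    rewrite conj_flow by assumption.
    replace ((Cconj p * z - 1) / flow_den p T z + 1)%C
      with ((flow_den p T z + (Cconj p * z - 1)) / flow_den p T z)%C by (field; assumption).
    rewrite Cmod_div by assumption. field. intros E. rewrite E in Hd2. lra. }
  rewrite E. pose proof (Cmod2_flow_den T (Cconj p * z)) as E2.
  rewrite Cmod_conj_mul in E2. fold (flow_den p T z) in E2. rewrite <- E2. field.
  intros E'. rewrite E' in Hd2. lra.
Qed.

Lemma disk_flow T z : disk z -> disk (flow p T z).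
Proof.
  intros Hz. apply Cmod_lt1_sq. pose proof (Cmod2_flow T z Hz) as E.
  pose proof (flow_den_gt0 T z Hz) as Hd. apply Cmod_lt1_sq in Hz.
  assert (0 < (1 - Cmod z ^ 2) / Cmod (flow_den p T z) ^ 2) by (apply Rdiv_lt_0_compat; lra).
  lra.
Qed.

Lemma flow_0 z : flow p 0 z = z.
Proof.
  unfold flow. replace (flow_den p 0 z) with (RtoC 1) by (unfold flow_den; ring).
  field.
Qed.

Lemma flow_flow S T z : disk z -> flow p S (flow p T z) = flow p (S + T) z.
Proof.
  intros Hz. pose proof (flow_den_neq0 T z Hz) as H1.
  pose proof (flow_den_neq0 (S + T) z Hz) as H2.
  (* The denominators form a cocycle over the flow. *)
  assert (E : flow_den p S (flow p T z) = (flow_den p (S + T) z / flow_den p T z)%C).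
  { unfold flow_den at 1. rewrite conj_flow by assumption.
    unfold flow_den in *. rewrite RtoC_plus in *. field. assumption. }
  unfold flow at 1. rewrite E. rewrite minus_p, conj_flow by assumption.
  unfold flow. rewrite minus_p. field. split; assumption.
Qed.

End Flow.

(** The two bounds together say A n^2 + |B| n <= c, which fails for large n if A > 0, or if A = 0
    and B is nonzero. Only integers occur, since the points tested are iterates of one map. *)
Lemma quadratic_bounded_nonpos (A B c : R) :
  (forall n : nat, A * INR n ^ 2 + B * INR n <= c) ->
  (forall n : nat, A * INR n ^ 2 - B * INR n <= c) -> A <= 0 /\ (A = 0 -> B = 0).
Proof.
  intros H1 H2. split.
  - destruct (Rle_lt_dec A 0) as [|HA]; [assumption|exfalso].
    destruct (nfloor_ex (Rabs c / A + 1)) as [n [_ Hn]].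
    { pose proof (Rabs_pos c). assert (0 <= Rabs c / A) by (apply Rdiv_le_0_compat; lra). lra. }
    specialize (H1 (Datatypes.S n)). specialize (H2 (Datatypes.S n)).
    rewrite S_INR in *. set (x := INR n + 1) in *.
    assert (Hx : Rabs c < A * (x - 1)).
    { apply Rmult_lt_reg_r with (/ A); [now apply Rinv_0_lt_compat|].
      replace (A * (x - 1) * / A) with (x - 1) by (field; lra).
      change (Rabs c / A < x - 1). lra. }
    pose proof (Rle_abs c). pose proof (Rabs_pos c).
    assert (x > 1) by nra. nra.
  - intros HA. subst A. destruct (Req_dec B 0) as [|HB]; [assumption|exfalso].
    assert (HB' : 0 < Rabs B) by now apply Rabs_pos_lt.
    destruct (nfloor_ex (Rabs c / Rabs B)) as [n [_ Hn]].
    { apply Rdiv_le_0_compat; [apply Rabs_pos|assumption]. }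
    assert (Hx : Rabs c < Rabs B * (INR n + 1)).
    { apply Rmult_lt_reg_r with (/ Rabs B); [now apply Rinv_0_lt_compat|].
      replace (Rabs B * (INR n + 1) * / Rabs B) with (INR n + 1) by (field; lra). exact Hn. }
    specialize (H1 (Datatypes.S n)). specialize (H2 (Datatypes.S n)). rewrite S_INR in *.
    pose proof (Rle_abs c).
    unfold Rabs in HB', Hx at 2. destruct (Rcase_abs B); lra.
Qed.

(** * Normal form of parabolic automorphisms *)

(** The point of modulus 1 - |beta| / 2 in the direction of beta is sent to modulus 1 + |beta| / 2.
    It exists with a positive multiplier t because |beta| = |phi(0)| < 1. *)
Lemma translation_not_disk_map (phi : C -> C) (beta : C) :
  beta <> 0%C -> (forall z, disk z -> disk (phi z)) ->
  (forall z, disk z -> phi z = z + beta)%C -> False.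
Proof.
  intros Hb Hmap Hphi. apply Cmod_gt_0 in Hb.
  assert (H1 : Cmod beta < 1).
  { replace beta with (phi 0%C).
    - apply Hmap. unfold disk. rewrite Cmod_0. lra.
    - rewrite Hphi; [ring|]. unfold disk. rewrite Cmod_0. lra. }
  set (t := / Cmod beta - 1 / 2).
  assert (Ht : Rabs t * Cmod beta = 1 - Cmod beta / 2).
  { unfold t. rewrite Rabs_pos_eq.
    - field. lra.
    - assert (1 < / Cmod beta) by (rewrite <- Rinv_1; apply Rinv_lt_contravar; lra). lra. }
  assert (Hd : disk (t * beta)%C).
  { unfold disk. rewrite Cmod_mult, Cmod_R. lra. }
  pose proof (Hmap _ Hd) as H. rewrite Hphi in H by assumption.
  unfold disk in H. replace (t * beta + beta)%C with (RtoC (t + 1) * beta)%C in H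
    by (rewrite RtoC_plus; ring).
  rewrite Cmod_mult, Cmod_R in H. unfold t in H.
  assert (0 < / Cmod beta) by now apply Rinv_0_lt_compat.
  rewrite Rabs_pos_eq in H by lra.
  replace ((/ Cmod beta - 1 / 2 + 1) * Cmod beta) with (1 + Cmod beta / 2) in H by (field; lra).
  lra.
Qed.

(* With s = 1 / (z - p), [cayley_form p s > 0] expresses |z| < 1. *)
Definition cayley_form (p s : C) : R := Cmod s ^ 2 - Cmod (p * s + 1)%C ^ 2.

Lemma cayley_form_disk (p s : C) : s <> 0%C -> (0 < cayley_form p s <-> disk (p + / s)%C).
Proof.
  intros Hs. unfold cayley_form, disk. rewrite Cmod_lt1_sq.
  replace (p + / s)%C with ((p * s + 1) / s)%C by (field; assumption).
  rewrite Cmod_div by assumption. apply Cmod_gt_0 in Hs.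
  replace ((Cmod (p * s + 1)%C / Cmod s) ^ 2) with (Cmod (p * s + 1)%C ^ 2 / Cmod s ^ 2)
    by (field; lra).
  assert (H2 : 0 < Cmod s ^ 2) by nra.
  split; intros H.
  - apply Rmult_lt_reg_r with (Cmod s ^ 2); [assumption|].
    unfold Rdiv. rewrite Rmult_assoc, Rinv_l; lra.
  - apply (Rmult_lt_compat_r (Cmod s ^ 2)) in H; [|assumption].
    unfold Rdiv in H. rewrite Rmult_assoc, Rinv_l in H; lra.
Qed.

(** Along an orbit of the translation the form is a quadratic polynomial in the step count. For
    nonzero k its leading coefficient vanishes exactly when |p| = 1. *)
Lemma cayley_form_line (p s k : C) (x : R) :
  cayley_form p (s + x * k)%C =
  cayley_form p s + x * (2 * Re (s * Cconj k)%C - 2 * Re ((p * s + 1) * Cconj (p * k)))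
  + x ^ 2 * ((1 - Cmod p ^ 2) * Cmod k ^ 2).
Proof.
  unfold cayley_form. rewrite !Cmod2_alt. destruct p, s, k. simpl. ring.
Qed.

Lemma cayley_form_0 p : cayley_form p 0 = - 1.
Proof. unfold cayley_form. rewrite Cmult_0_r, Cplus_0_l, Cmod_0, Cmod_1. ring. Qed.

(* In the coordinate s the map phi is the translation by k; it preserves the
   sign of [cayley_form] on the whole orbit, which forces |p| = 1. *)
Lemma parabolic_map_normal_form (phi : C -> C) (p k : C) :
  (forall z, disk z -> disk (phi z)) ->
  (forall w, disk w -> exists z, disk z /\ phi z = w) ->
  k <> 0%C ->
  (forall z, disk z -> (1 + k * (z - p))%C <> 0%C) ->
  (forall z, disk z -> phi z = (p + (z - p) / (1 + k * (z - p)))%C) ->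
  exists tau : R, Cmod p = 1 /\ tau <> 0 /\ k = (Ci * tau * Cconj p)%C.
Proof.
  intros Hmap Hsurj Hk Hden Hphi.
  assert (Hne0 : forall s : C, 0 < cayley_form p s -> s <> 0%C).
  { intros s Hs E. rewrite E, cayley_form_0 in Hs. lra. }
  assert (Hfwd : forall s : C, 0 < cayley_form p s -> 0 < cayley_form p (s + k)%C).
  { intros s Hs. pose proof (Hne0 s Hs) as Hs0.
    assert (Hd : disk (p + / s)%C) by now apply cayley_form_disk.
    pose proof (Hden _ Hd) as H1. pose proof (Hphi _ Hd) as H2.
    assert (Hsk : (s + k)%C <> 0%C).
    { intros E. apply H1. replace (1 + k * (p + / s - p))%C with ((s + k) / s)%C by (field; assumption).
      rewrite E. field. assumption. }
    apply cayley_form_disk; [assumption|].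
    replace (p + / (s + k))%C with (phi (p + / s)%C); [now apply Hmap|].
    rewrite H2. field. repeat split; assumption. }
  assert (Hbwd : forall s : C, 0 < cayley_form p (s + k)%C -> 0 < cayley_form p s).
  { intros s Hs. pose proof (Hne0 _ Hs) as Hs0.
    assert (Hd : disk (p + / (s + k))%C) by now apply cayley_form_disk.
    destruct (Hsurj _ Hd) as [z [Hz E]]. rewrite Hphi in E by assumption.
    pose proof (Hden z Hz) as H1.
    set (w := (z - p)%C) in *. set (D := (1 + k * w)%C) in *.
    assert (E1 : (w / D = / (s + k))%C).
    { replace (w / D)%C with (p + w / D - p)%C by ring. rewrite E. ring. }
    assert (E2 : (w * s = 1)%C).
    { replace (w * s)%C with (D * (w / D) * (s + k) - k * w)%C by (field; assumption).
      rewrite E1. unfold D. field. assumption. }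
    assert (Hs1 : s <> 0%C).
    { intros E3. rewrite E3, Cmult_0_r in E2. apply RtoC_inj in E2. lra. }
    apply cayley_form_disk; [assumption|].
    replace (p + / s)%C with z; [assumption|].
    replace (/ s)%C with (w * s * / s)%C by (rewrite E2; ring).
    unfold w. field. assumption. }
  assert (Hn : forall e : R, (e = 1 \/ e = -1) -> forall s : C, 0 < cayley_form p s ->
     forall n, 0 < cayley_form p (s + RtoC (e * INR n) * k)%C).
  { intros e He s Hs n. induction n as [|n IH].
    - replace (s + RtoC (e * INR 0) * k)%C with s; [assumption|]. simpl. rewrite Rmult_0_r. ring.
    - rewrite S_INR. destruct He as [-> | ->].
      + replace (s + RtoC (1 * (INR n + 1)) * k)%C with (s + RtoC (1 * INR n) * k + k)%C; [now apply Hfwd|].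
        rewrite !RtoC_mult, RtoC_plus. ring.
      + apply Hbwd. replace (s + RtoC (-1 * (INR n + 1)) * k + k)%C with (s + RtoC (-1 * INR n) * k)%C; [assumption|].
        rewrite !RtoC_mult, RtoC_plus. ring. }
  (* The coordinate s = 0 stands for z = infinity. If one of its iterates entered the disk, stepping
     back would make the form positive at 0, where it is -1. This bounds the quadratic from above in
     both directions. *)
  assert (Hneg : forall e : R, (e = 1 \/ e = -1) -> forall n,
     cayley_form p (RtoC 0 + RtoC (e * INR n) * k)%C <= 0).
  { intros e He n. apply Rnot_lt_le. intros H.
    apply (Hn (- e)) with (n := n) in H; [|lra].
    replace (RtoC 0 + RtoC (e * INR n) * k + RtoC (- e * INR n) * k)%C with (RtoC 0) in H.
    - rewrite cayley_form_0 in H. lra.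
    - rewrite !RtoC_mult, RtoC_opp. ring. }
  set (A := (1 - Cmod p ^ 2) * Cmod k ^ 2).
  pose proof (proj1 (Cmod_gt_0 k) Hk) as Hk0.
  set (B := 2 * Re (RtoC 0 * Cconj k)%C - 2 * Re ((p * RtoC 0 + 1) * Cconj (p * k))%C).
  destruct (quadratic_bounded_nonpos A B 1) as [HA HB].
  { intros n. pose proof (Hneg 1 (or_introl eq_refl) n) as H.
    rewrite cayley_form_line, cayley_form_0 in H. fold A B in H. lra. }
  { intros n. pose proof (Hneg (-1) (or_intror eq_refl) n) as H.
    rewrite cayley_form_line, cayley_form_0 in H. fold A B in H. lra. }
  assert (Hp1 : 1 <= Cmod p).
  { apply Rnot_lt_le. intros H. apply Cmod_lt1_sq in H. assert (0 < Cmod k ^ 2) by nra.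
    unfold A in HA. nra. }
  assert (Hp0 : p <> 0%C) by (apply Cmod_gt_0; lra).
  (* The coordinate of z = 0, whose orbit stays inside the disk in both directions; this bounds a
     quadratic with the same leading coefficient from below. *)
  set (s0 := (- / p)%C).
  assert (Hs0 : 0 < cayley_form p s0).
  { unfold cayley_form, s0. replace (p * - / p + 1)%C with (RtoC 0) by (field; assumption).
    rewrite Cmod_0, Cmod_opp, Cmod_inv by assumption.
    assert (0 < / Cmod p) by (apply Rinv_0_lt_compat; lra). nra. }
  assert (HA' : - A <= 0).
  { apply (quadratic_bounded_nonpos (- A)
      (- (2 * Re (s0 * Cconj k)%C - 2 * Re ((p * s0 + 1) * Cconj (p * k))%C)) (cayley_form p s0)).
    - intros n. pose proof (Hn 1 (or_introl eq_refl) s0 Hs0 n) as H.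
      rewrite cayley_form_line in H. fold A in H. lra.
    - intros n. pose proof (Hn (-1) (or_intror eq_refl) s0 Hs0 n) as H.
      rewrite cayley_form_line in H. fold A in H. lra. }
  assert (HA0 : A = 0) by lra.
  assert (Hpm : Cmod p = 1).
  { unfold A in HA0. apply Rmult_integral in HA0. destruct HA0 as [E|E]; nra. }
  (* At s = 0 the linear coefficient B is -2 Re (p k), so p k is purely imaginary; [tau] is its
     imaginary part. *)
  assert (HRe : Re (p * k)%C = 0).
  { specialize (HB HA0). unfold B in HB. destruct p, k. simpl in *. lra. }
  exists (Im (p * k)%C). split; [assumption|].
  assert (E : k = (Ci * Im (p * k)%C * Cconj p)%C).
  { replace (Ci * Im (p * k)%C)%C with (p * k)%C.
    - replace (p * k * Cconj p)%C with (p * Cconj p * k)%C by ring.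
      rewrite conj_mul_self by assumption. ring.
    - apply injective_projections; simpl; unfold Re, Im in *; simpl in *; lra. }
  split; [|exact E].
  intros E0. apply Hk. rewrite E, E0. ring.
Qed.

Lemma parabolic_automorphism_flow (phi : C -> C) :
  parabolic_automorphism phi ->
  exists (p : C) (tau : R), Cmod p = 1 /\ tau <> 0 /\ forall z, disk z -> phi z = flow p tau z.
Proof.
  intros [[_ [Hmap [_ Hsurj]]] [m [[[a [b [c [d [Hdet Hm]]]]] [[w0 Hw0] [w1 [Hw1 Huniq]]]] Hphi]]].
  assert (Hfin : forall z, disk z -> (c * z + d <> 0 /\ phi z = (a * z + b) / (c * z + d))%C).
  { intros z Hz. specialize (Hphi z Hz). rewrite Hm in Hphi. unfold mobius in Hphi.
    destruct (Ceq_dec (c * z + d) 0); [discriminate|]. split; [assumption|]. now injection Hphi. }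
  destruct (Ceq_dec c 0) as [Hc|Hc].
  (* Here infinity is the fixed point. A second fixed point b / (d - a) would exist unless a = d, so
     the map is a translation by b / d. *)
  - subst c. exfalso.
    assert (Hd : d <> 0%C).
    { intros E. apply Hdet. rewrite E. ring. }
    assert (Ha : a <> 0%C).
    { intros E. apply Hdet. rewrite E. ring. }
    assert (Hinf : m None = None).
    { rewrite Hm. unfold mobius. destruct (Ceq_dec 0 0); congruence. }
    assert (Hw1n : w1 = None) by now apply Huniq. subst w1.
    assert (Had : a = d).
    { destruct (Ceq_dec d a) as [|Hda]; [congruence|exfalso].
      assert (Hda' : (d - a)%C <> 0%C) by (intros E; apply Hda; rewrite <- (Cplus_0_l a), <- E; ring).
      assert (E : None = Some (b / (d - a))%C).
      { apply Huniq. rewrite Hm. unfold mobius.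
        destruct (Ceq_dec (0 * (b / (d - a)) + d) 0) as [E|_].
        - exfalso. apply Hd. rewrite <- E. ring.
        - f_equal. field. split; [assumption|]. intros E. apply Hd. rewrite <- E. ring. }
      discriminate. }
    subst a. apply (translation_not_disk_map phi (b / d)%C).
    + intros Hb. apply Hw0. rewrite Hm. destruct w0 as [z|]; unfold mobius.
      * destruct (Ceq_dec (0 * z + d) 0) as [E|_].
        -- exfalso. apply Hd. rewrite <- E. ring.
        -- f_equal. replace ((d * z + b) / (0 * z + d))%C with (z + b / d)%C by (field; assumption).
           rewrite Hb. ring.
      * destruct (Ceq_dec 0 0); congruence.
    + assumption.
    + intros z Hz. destruct (Hfin z Hz) as [_ ->]. field. assumption.
  - destruct w1 as [p|].
    2: { exfalso. rewrite Hm in Hw1. unfold mobius in Hw1. destruct (Ceq_dec c 0); [contradiction|discriminate]. }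
    assert (Hfix : forall z, (c * z + d)%C <> 0%C -> (a * z + b = z * (c * z + d))%C -> z = p).
    { intros z Hz E. assert (Some p = Some z) as F.
      { apply Huniq. rewrite Hm. unfold mobius. destruct (Ceq_dec (c * z + d) 0); [contradiction|].
        f_equal. rewrite E. field. assumption. }
      congruence. }
    rewrite Hm in Hw1. unfold mobius in Hw1.
    destruct (Ceq_dec (c * p + d) 0) as [|Hcp]; [discriminate|].
    injection Hw1 as Hw1.
    assert (Hp : (a * p + b = p * (c * p + d))%C).
    { rewrite <- Hw1 at 2. field. assumption. }
    (* The other root of the fixed point equation c z^2 + (d - a) z - b = 0, by Vieta. Uniqueness of
       the fixed point makes p a double root, which determines a and b from c, d and p. *)
    set (q := ((a - d) / c - p)%C).
    assert (Hq : (a * q + b = q * (c * q + d))%C).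
    { replace (a * q + b)%C with (a * p + b + a * (q - p))%C by ring. rewrite Hp.
      unfold q. field. assumption. }
    assert (Hqp : q = p).
    { apply Hfix; [|assumption]. intros E. rewrite E, Cmult_0_r in Hq. apply Hdet.
      replace (a * d - b * c)%C with (a * (c * q + d) - c * (a * q + b))%C by ring.
      rewrite E, Hq. ring. }
    assert (Ea : a = (d + (c * p + c * p))%C).
    { replace (c * p + c * p)%C with (c * (q + p))%C by (rewrite Hqp; ring). unfold q. field. assumption. }
    assert (Eb : b = (- (c * p * p))%C).
    { replace b with (a * p + b - a * p)%C by ring. rewrite Hp, Ea. ring. }
    set (k := (c / (c * p + d))%C).
    assert (Hk : k <> 0%C).
    { intros E. apply Hc. replace c with (k * (c * p + d))%C by (unfold k; field; assumption). rewrite E. ring. }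
    assert (Hkz : forall z, (1 + k * (z - p) = (c * z + d) / (c * p + d))%C).
    { intros z. unfold k. field. assumption. }
    assert (Hden : forall z, disk z -> (1 + k * (z - p))%C <> 0%C).
    { intros z Hz E. destruct (Hfin z Hz) as [Hz1 _]. apply Hz1.
      replace (c * z + d)%C with ((1 + k * (z - p)) * (c * p + d))%C by (rewrite Hkz; field; assumption).
      rewrite E. ring. }
    destruct (parabolic_map_normal_form phi p k Hmap Hsurj Hk Hden) as [tau [Hp1 [Htau Ek]]].
    { intros z Hz. destruct (Hfin z Hz) as [Hz1 ->]. rewrite Hkz, Ea, Eb. field. split; assumption. }
    exists p, tau. split; [assumption|]. split; [assumption|]. intros z Hz.
    destruct (Hfin z Hz) as [Hz1 ->]. unfold flow.
    replace (flow_den p tau z) with (1 + k * (z - p))%C.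
    { rewrite Hkz, Ea, Eb. field. split; assumption. }
    unfold flow_den. rewrite Ek, (minus_p p Hp1 z).
    replace (Ci * tau * Cconj p * (p * (Cconj p * z - 1)))%C
      with (Ci * tau * (p * Cconj p) * (Cconj p * z - 1))%C by ring.
    rewrite conj_mul_self by assumption. ring.
Qed.

(** * Recurrence and duality *)

(* Equations produced by [sum_n_ext] live in the carrier of a normed module, where
   [ring] and [field] do not recognize R. *)
Ltac eq_in_R := match goal with |- @eq _ ?x ?y => change (@eq R x y) end.

Lemma iter_weighted_comp (phi : C -> C) (p lambda : C) (tau : R) (n : nat) (f : C -> C) (z : C) :
  Cmod p = 1 -> (forall z, disk z -> phi z = flow p tau z) -> disk z ->
  Nat.iter n (weighted_comp lambda phi) f z = (lambda ^ n * f (flow p (INR n * tau) z))%C.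
Proof.
  intros Hp Hphi. revert z. induction n as [|n IH]; intros z Hz.
  - simpl. rewrite Rmult_0_l, flow_0. ring.
  - change (weighted_comp lambda phi (Nat.iter n (weighted_comp lambda phi) f) z
      = (lambda ^ S n * f (flow p (INR (S n) * tau) z))%C).
    unfold weighted_comp at 1. rewrite Hphi by assumption.
    rewrite IH by now apply disk_flow. rewrite flow_flow by assumption.
    rewrite S_INR. replace ((INR n + 1) * tau) with (INR n * tau + tau) by ring.
    simpl. ring.
Qed.

Lemma dirichlet_norm_lt nu f rho : norm_lt nu f rho -> dirichlet nu f.
Proof. intros H. apply dirichletE. now exists rho. Qed.

Lemma dirichlet_open_ball nu f0 delta :
  dirichlet_open nu (fun f => dirichlet nu f /\ norm_lt nu (fun z => f z - f0 z)%C delta).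
Proof.
  split; [tauto|]. intros f [_ Hf]. apply norm_ltE in Hf. destruct Hf as [r [Hr Hrd]].
  (* Half of the gap: the other half leaves room for the strict bound on f - f0. *)
  exists ((delta - r) / 2). split; [lra|]. intros g s Hg Hs Hlt. split; [assumption|].
  replace delta with ((delta - r) / 2 + (delta + r) / 2) by field.
  apply norm_lt_minus_trans with f; apply norm_ltE.
  - exists s. split; [exact Hs|assumption].
  - exists r. split; [assumption|lra].
Qed.

Lemma recurrent_near nu T f0 delta :
  recurrent nu T -> dirichlet nu f0 -> 0 < delta ->
  exists n f, (0 < n)%nat /\ norm_lt nu (fun z => f z - f0 z)%C delta /\
    norm_lt nu (fun z => Nat.iter n T f z - f0 z)%C delta.
Proof.
  intros HT Hf0 Hd.
  destruct (HT _ (dirichlet_open_ball nu f0 delta)) as [n [Hn [f [[_ H1] [_ H2]]]]].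
  - exists f0. split; [assumption|]. apply norm_lt_0; [intros; ring|assumption].
  - now exists n, f.
Qed.

(** The coefficients are those of [mono_geom k 0]: the sequence 0^j, with 0^0 = 1, shifted by k.
    This holds for every real nu. *)
Lemma dirichlet_monomial nu k : dirichlet nu (fun z => z ^ k)%C.
Proof.
  assert (H0 : Cmod 0 < 1) by (rewrite Cmod_0; lra).
  pose proof (has_taylor_mono_geom k _ H0) as H.
  assert (HS : sqnorm_series nu (@PS_incr_n C_AbsRing C_NormedModule (fun j => (RtoC 0 ^ j)%C) k)
    (weight nu k * / (1 - 0))).
  { apply (is_series_shift _ k).
    - intros j Hj. rewrite PS_incr_n_simplify. destruct (Compare_dec.le_lt_dec k j); [lia|].
      change (Cmod (RtoC 0) ^ 2 * weight nu j = 0). rewrite Cmod_0. ring.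
    - generalize (Rseries_scal (weight nu k) _ _ (is_series_geom 0 ltac:(rewrite Rabs_R0; lra))).
      apply is_series_ext. intros j. rewrite PS_incr_n_simplify.
      destruct (Compare_dec.le_lt_dec k (k + j)) as [_|]; [|lia].
      replace (k + j - k)%nat with j by lia. rewrite Cmod_pow, Cmod_0.
      destruct j as [|j].
      + rewrite Nat.add_0_r. simpl. ring.
      + simpl. ring. }
  assert (HT : has_taylor (fun z => z ^ k)%C
    (@PS_incr_n C_AbsRing C_NormedModule (fun j => (RtoC 0 ^ j)%C) k)).
  { apply (has_taylor_ext (mono_geom k 0)); [|assumption].
    intros z _. unfold mono_geom. rewrite Cmult_0_l. field. }
  pose proof (weight_gt0 nu k). rewrite Rminus_0_r, Rinv_1, Rmult_1_r in HS.
  apply dirichletE. exists (weight nu k + 1). split; [lra|].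
  eexists _, _. split; [exact HT|]. split; [exact HS|]. nra.
Qed.

(** * Cauchy-Schwarz and polynomially weighted geometric sums *)

Lemma Rsum_Sn (u : nat -> R) (n : nat) : sum_n u (S n) = sum_n u n + u (S n).
Proof. exact (sum_Sn u n). Qed.

(** Young's inequality term by term. Leaving the ratio c free avoids dividing by sums that may
    vanish. *)
Lemma sum_n_mult_le (A B : nat -> R) (c : R) (n : nat) : 0 < c ->
  sum_n (fun k => A k * B k) n <=
  c / 2 * sum_n (fun k => A k ^ 2) n + / (2 * c) * sum_n (fun k => B k ^ 2) n.
Proof.
  intros Hc.
  assert (H : forall x y : R, x * y <= c / 2 * x ^ 2 + / (2 * c) * y ^ 2).
  { intros x y. assert (0 <= (c * x - y) ^ 2 / (2 * c)).
    { apply Rdiv_le_0_compat; [apply pow2_ge_0|lra]. }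
    replace (c / 2 * x ^ 2 + / (2 * c) * y ^ 2) with (x * y + (c * x - y) ^ 2 / (2 * c)) by (field; lra).
    lra. }
  induction n as [|n IH].
  - rewrite !sum_O. apply H.
  - rewrite !Rsum_Sn. specialize (H (A (S n)) (B (S n))). lra.
Qed.

Lemma Cauchy_Schwarz_partial (A B : nat -> R) (S d M : R) (n : nat) :
  0 < d -> 0 < M -> (forall k, 0 <= A k ^ 2) -> is_series (fun k => A k ^ 2) S -> S < d ^ 2 ->
  sum_n (fun k => B k ^ 2) n <= M ^ 2 -> sum_n (fun k => A k * B k) n <= d * M.
Proof.
  intros Hd HM HA HS HSd HB.
  pose proof (Rsum_le_series _ S n HA HS) as H1.
  (* The balancing ratio: each of the two halves is then at most d M / 2. *)
  assert (Hc : 0 < M / d) by now apply Rdiv_lt_0_compat.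
  eapply Rle_trans; [apply (sum_n_mult_le A B (M / d) n Hc)|].
  replace (d * M) with (M / d / 2 * d ^ 2 + / (2 * (M / d)) * M ^ 2) by (field; lra).
  assert (0 < / (2 * (M / d))) by (apply Rinv_0_lt_compat; lra).
  apply Rplus_le_compat; apply Rmult_le_compat_l; lra.
Qed.

(* Duality bound: [c k] are the coefficients of a linear functional. *)
Lemma functional_bound nu (a c : nat -> C) (S d M : R) (l : C) :
  0 < d -> 0 < M -> sqnorm_series nu a S -> S < d ^ 2 ->
  (forall n, sum_n (fun k => Cmod (c k) ^ 2 / weight nu k) n <= M ^ 2) ->
  Cseries (fun k => (a k * c k)%C) l -> Cmod l <= d * M.
Proof.
  intros Hd HM HS HSd Hc Hl. apply (Cseries_bound _ _ _ Hl). intros n.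
  assert (Hw : forall k, 0 < sqrt (weight nu k)) by (intros; apply sqrt_lt_R0, weight_gt0).
  assert (Hw2 : forall k, sqrt (weight nu k) ^ 2 = weight nu k)
    by (intros; apply pow2_sqrt, Rlt_le, weight_gt0).
  rewrite (sum_n_ext _ (fun k => (Cmod (a k) * sqrt (weight nu k)) * (Cmod (c k) / sqrt (weight nu k)))).
  - apply (Cauchy_Schwarz_partial _ _ S); try assumption.
    + intros k. apply pow2_ge_0.
    + revert HS. apply is_series_ext. intros k. rewrite Rpow_mult_distr, Hw2. reflexivity.
    + eapply Rle_trans; [|apply (Hc n)]. right. apply sum_n_ext. intros k.
      pose proof (Hw2 k) as E. specialize (Hw k). set (s := sqrt (weight nu k)) in *.
      rewrite <- E. eq_in_R. field. lra.
  - intros k. rewrite Cmod_mult. eq_in_R. field. specialize (Hw k). lra.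
Qed.

Lemma pow_succ_diff_le (a b : R) (M : nat) : 0 <= a <= b ->
  b ^ S M - a ^ S M <= INR (S M) * b ^ M * (b - a).
Proof.
  intros H. induction M as [|M IH].
  - simpl. lra.
  - rewrite (S_INR (S M)). change (b ^ S (S M)) with (b * b ^ S M).
    change (a ^ S (S M)) with (a * a ^ S M).
    replace (b * b ^ S M - a * a ^ S M) with (b ^ S M * (b - a) + a * (b ^ S M - a ^ S M)) by ring.
    assert (0 <= INR (S M)) by apply pos_INR.
    assert (0 <= b ^ M) by (apply pow_le; lra).
    assert (0 <= b ^ S M - a ^ S M) by (pose proof (pow_incr a b (S M) H); lra).
    assert (a * (b ^ S M - a ^ S M) <= b * (INR (S M) * b ^ M * (b - a))) by nra.
    change (b ^ S M) with (b * b ^ M) in *. nra.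
Qed.

(** Summation by parts: multiplying by 1 - x replaces (k+1)^(M+1) by its difference, at most
    (M+1)(k+1)^M, so each degree costs a factor (M+1) / (1 - x). *)
Lemma poly_geom_sum_le (M : nat) (x : R) (n : nat) : 0 <= x < 1 ->
  sum_n (fun k => (INR k + 1) ^ M * x ^ k) n <= INR (fact M) / (1 - x) ^ S M.
Proof.
  intros Hx. revert n. induction M as [|M IH]; intros n.
  - replace (INR (fact 0) / (1 - x) ^ 1) with (/ (1 - x)) by (simpl; field; lra).
    apply Rsum_le_series.
    + intros k. simpl. rewrite Rmult_1_l. apply pow_le; lra.
    + eapply is_series_ext; [|apply (is_series_geom x); rewrite Rabs_pos_eq; lra].
      intros k. simpl. ring.
  (* The boundary term stays on the left so that the induction on n closes. *)
  - assert (H : (1 - x) * sum_n (fun k => (INR k + 1) ^ S M * x ^ k) n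
        + (INR n + 1) ^ S M * x ^ S n
        <= INR (S M) * sum_n (fun k => (INR k + 1) ^ M * x ^ k) n).
    { induction n as [|n IHn].
      - rewrite !sum_O. assert (1 <= INR (S M)) by (apply (le_INR 1); lia).
        simpl (INR 0). rewrite Rplus_0_l, !pow1. simpl pow. lra.
      - rewrite !Rsum_Sn.
        pose proof (pos_INR n) as Hn.
        pose proof (pow_succ_diff_le (INR n + 1) (INR (S n) + 1) M) as HD.
        rewrite S_INR in *. specialize (HD ltac:(lra)).
        replace (INR n + 1 + 1 - (INR n + 1)) with 1 in HD by ring.
        assert (Hxn : 0 <= x ^ S n) by (apply pow_le; lra).
        apply (Rmult_le_compat_r (x ^ S n)) in HD; [|assumption].
        change (x ^ S (S n)) with (x * x ^ S n).
        rewrite !S_INR in *. lra. }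
    assert (Hpos : 0 <= (INR n + 1) ^ S M * x ^ S n).
    { apply Rmult_le_pos; apply pow_le; [pose proof (pos_INR n); lra|lra]. }
    specialize (IH n). apply (Rmult_le_compat_l (INR (S M))) in IH; [|apply pos_INR].
    rewrite fact_simpl, mult_INR.
    apply Rmult_le_reg_l with (1 - x); [lra|].
    replace ((1 - x) * (INR (S M) * INR (fact M) / (1 - x) ^ S (S M)))
      with (INR (S M) * (INR (fact M) / (1 - x) ^ S M)).
    + lra.
    + simpl. field. split; [apply pow_nonzero|]; lra.
Qed.

(** * Necessity *)

Lemma inv_weight_le_pow nu : exists M, forall k, / weight nu k <= (INR k + 1) ^ M.
Proof.
  destruct (INR_unbounded (- (2 * nu))) as [M HM]. exists M. intros k.
  unfold weight. rewrite <- Rpower_Ropp, <- Rpower_pow by (pose proof (pos_INR k); lra).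
  apply Rle_Rpower; pose proof (pos_INR k); lra.
Qed.

Lemma Cmod2_flow_den_0 p T : Cmod (flow_den p T 0) ^ 2 = 1 + T ^ 2.
Proof. unfold flow_den. rewrite Cmod2_alt. destruct p. simpl. ring. Qed.

Lemma disk_0 : disk 0.
Proof. unfold disk. rewrite Cmod_0. lra. Qed.

(** Evaluation at w has squared norm equal to the sum of |w|^(2k) / [weight], at most M! / (1 -
    |w|^2)^(M+1). At w = [flow p T 0] the quantity 1 - |w|^2 is 1 / (1 + T^2). The bound is at least
    1, so its own square majorizes it; any polynomial rate suffices. *)
Lemma eval_flow_bound nu : exists N c, 0 < c /\
  forall p T h d, Cmod p = 1 -> norm_lt nu h d ->
    Cmod (h (flow p T 0)) <= d * (c * (1 + T ^ 2) ^ N).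
Proof.
  destruct (inv_weight_le_pow nu) as [M HM].
  exists (S M), (INR (fact M)).
  assert (Hf : 1 <= INR (fact M)) by (apply (le_INR 1), lt_O_fact).
  split; [lra|]. intros p T h d Hp [Hd [a [S0 [Ha [HS HSd]]]]].
  assert (HD : disk (flow p T 0)) by apply (disk_flow p Hp T 0 disk_0).
  rewrite has_taylorE in Ha. specialize (Ha _ HD).
  pose proof (pow2_ge_0 T) as HT.
  assert (HTM : 1 <= (1 + T ^ 2) ^ S M) by (apply pow_R1_Rle; lra).
  refine (functional_bound nu _ _ S0 d _ _ Hd _ HS HSd _ Ha); [nra|].
  intros n. pose proof (Cmod2_flow p Hp T 0 disk_0) as Hx.
  rewrite Cmod2_flow_den_0, Cmod_0 in Hx. set (x := Cmod (flow p T 0) ^ 2) in *.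
  assert (Hx1 : 1 - x = / (1 + T ^ 2)) by (rewrite Hx; field; lra).
  assert (Hx2 : 0 < 1 - x) by (rewrite Hx1; apply Rinv_0_lt_compat; lra).
  assert (Hx0 : 0 <= x) by apply pow2_ge_0.
  apply Rle_trans with (sum_n (fun k => (INR k + 1) ^ M * x ^ k) n).
  - apply sum_n_m_le. intros k. rewrite Cmod_pow.
    replace ((Cmod (flow p T 0) ^ k) ^ 2) with (x ^ k)
      by (unfold x; rewrite <- !pow_mult; f_equal; lia).
    unfold Rdiv. rewrite Rmult_comm. apply Rmult_le_compat_r; [apply pow_le; lra|apply HM].
  - eapply Rle_trans; [apply poly_geom_sum_le; lra|]. rewrite Hx1.
    rewrite pow_inv. unfold Rdiv. rewrite Rinv_inv. set (u := (1 + T ^ 2) ^ S M) in *.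
    assert (1 <= INR (fact M) * u) by nra. nra.
Qed.

(** Since 1 + (n t)^2 <= (1 + t^2)(n+1)^2, the expression is a constant times one term of a
    nonnegative sum bounded by [poly_geom_sum_le]. *)
Lemma poly_mul_geom_bounded (N : nat) (mu c t : R) : 0 <= mu < 1 -> 0 < c ->
  exists K, 0 < K /\ forall n : nat, mu ^ n * (c * (1 + (INR n * t) ^ 2) ^ N) <= K.
Proof.
  intros Hmu Hc. set (K := INR (fact (2 * N)) / (1 - mu) ^ S (2 * N)).
  pose proof (pow2_ge_0 t) as Ht2.
  assert (Ht : 0 < (1 + t ^ 2) ^ N) by (apply pow_lt; lra).
  exists (c * (1 + t ^ 2) ^ N * K). split.
  - apply Rmult_lt_0_compat; [nra|]. apply Rdiv_lt_0_compat; [apply INR_fact_lt_0|].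
    apply pow_lt. lra.
  - intros n. pose proof (pos_INR n) as Hn.
    assert (H1 : (1 + (INR n * t) ^ 2) ^ N <= (1 + t ^ 2) ^ N * (INR n + 1) ^ (2 * N)).
    { rewrite pow_mult, <- Rpow_mult_distr. apply pow_incr. nra. }
    assert (H2 : (INR n + 1) ^ (2 * N) * mu ^ n <= K).
    { eapply Rle_trans; [|apply (poly_geom_sum_le (2 * N) mu n Hmu)].
      set (u := fun k => (INR k + 1) ^ (2 * N) * mu ^ k). change (u n <= sum_n u n).
      assert (Hu : forall k, 0 <= u k).
      { intros k. apply Rmult_le_pos; apply pow_le; [pose proof (pos_INR k); lra|lra]. }
      assert (Hs : forall k, 0 <= sum_n u k).
      { intros k. induction k as [|k IH]; [rewrite sum_O; apply Hu|].
        rewrite Rsum_Sn. specialize (Hu (S k)). lra. }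
      destruct n; [rewrite sum_O; lra|]. rewrite Rsum_Sn. specialize (Hs n). lra. }
    assert (0 <= mu ^ n) by (apply pow_le; lra).
    apply Rle_trans with (c * (1 + t ^ 2) ^ N * ((INR n + 1) ^ (2 * N) * mu ^ n)).
    + replace (c * (1 + t ^ 2) ^ N * ((INR n + 1) ^ (2 * N) * mu ^ n))
        with (mu ^ n * (c * ((1 + t ^ 2) ^ N * (INR n + 1) ^ (2 * N)))) by ring.
      apply Rmult_le_compat_l; [assumption|]. apply Rmult_le_compat_l; lra.
    + apply Rmult_le_compat_l; [nra|assumption].
Qed.

Lemma Cmod_near_one (w : C) (e : R) : Cmod (w - 1)%C <= e -> 1 - e <= Cmod w <= 1 + e.
Proof.
  intros H. split.
  - pose proof (Cmod_triangle w (- (w - 1))%C) as H1. rewrite Cmod_opp in H1.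
    replace (w + - (w - 1))%C with (RtoC 1) in H1 by ring. rewrite Cmod_1 in H1. lra.
  - pose proof (Cmod_triangle (w - 1)%C 1) as H1.
    replace (w - 1 + 1)%C with w in H1 by ring. rewrite Cmod_1 in H1. lra.
Qed.

Lemma dirichlet_1 nu : dirichlet nu (fun _ => RtoC 1).
Proof.
  destruct (dirichlet_monomial nu 0) as [r Hr]. exists r. exact Hr.
Qed.

(** Two evaluation points are used. For |lambda| < 1 the iterate at 0 is lambda^n f(phi_n(0)), too
    small to be near 1. For |lambda| > 1 the iterate at the n-th backward point of 0 is lambda^n
    f(0), of at most polynomial size, so f(0) is too small. *)
Lemma recurrent_Cmod_lambda (phi : C -> C) (p lambda : C) (tau nu : R) :
  Cmod p = 1 -> (forall z, disk z -> phi z = flow p tau z) ->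
  recurrent nu (weighted_comp lambda phi) -> Cmod lambda = 1.
Proof.
  intros Hp Hphi Hrec.
  destruct (eval_flow_bound nu) as [N [c [Hc Hev]]].
  assert (Hgap : forall mu, 0 <= mu < 1 -> exists d, 0 < d /\ forall n, (0 < n)%nat ->
     ~ 1 - d * c <= mu ^ n * (1 + d * (c * (1 + (INR n * tau) ^ 2) ^ N))).
  { intros mu Hmu. destruct (poly_mul_geom_bounded N mu c tau Hmu Hc) as [K [HK HKn]].
    (* Chosen so that d c + d K is half of 1 - mu; with mu^n <= mu for n > 0, the inequality to
       refute would give 1 - mu <= (1 - mu) / 2. *)
    exists ((1 - mu) / (2 * (c + K))). split; [apply Rdiv_lt_0_compat; lra|].
    intros n Hn H. set (d := (1 - mu) / (2 * (c + K))) in *.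
    assert (Hd : d * (c + K) = (1 - mu) / 2) by (unfold d; field; lra).
    assert (Hd0 : 0 < d) by (apply Rdiv_lt_0_compat; lra).
    specialize (HKn n).
    assert (Hmun : mu ^ n <= mu).
    { destruct n; [lia|]. simpl. pose proof (pow_incr mu 1 n ltac:(lra)) as E.
      rewrite pow1 in E. nra. }
    apply (Rmult_le_compat_l d) in HKn; lra. }
  assert (Hn2 : forall n, 1 + (INR n * - tau) ^ 2 = 1 + (INR n * tau) ^ 2) by (intros; ring).
  assert (E0 : flow p 0 0 = 0%C) by apply flow_0.
  assert (Hev0 : forall h d, norm_lt nu h d -> Cmod (h (RtoC 0)) <= d * c).
  { intros h d Hh. pose proof (Hev p 0 h d Hp Hh) as H. rewrite E0 in H.
    replace (1 + 0 ^ 2) with 1 in H by ring. rewrite pow1, Rmult_1_r in H. exact H. }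
  destruct (Rtotal_order (Cmod lambda) 1) as [Hl|[Hl|Hl]]; [exfalso|assumption|exfalso].
  - destruct (Hgap (Cmod lambda)) as [d [Hd HG]]; [split; [apply Cmod_ge_0|assumption]|].
    destruct (recurrent_near _ _ _ d Hrec (dirichlet_1 nu) Hd) as [n [f [Hn [H1 H2]]]].
    apply (HG n Hn).
    apply Hev0 in H2. apply Cmod_near_one in H2.
    apply (Hev p (INR n * tau) _ _ Hp) in H1. apply Cmod_near_one in H1.
    rewrite (iter_weighted_comp phi p lambda tau n f 0 Hp Hphi disk_0) in H2.
    rewrite Cmod_mult, Cmod_pow in H2.
    apply Rle_trans with (1 := proj1 H2).
    apply Rmult_le_compat_l; [apply pow_le, Cmod_ge_0|lra].
  - assert (Hmu : 0 <= / Cmod lambda < 1).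
    { split; [apply Rlt_le, Rinv_0_lt_compat; lra|].
      rewrite <- Rinv_1. apply Rinv_lt_contravar; lra. }
    destruct (Hgap _ Hmu) as [d [Hd HG]].
    destruct (recurrent_near _ _ _ d Hrec (dirichlet_1 nu) Hd) as [n [f [Hn [H1 H2]]]].
    apply (HG n Hn).
    apply Hev0 in H1. apply Cmod_near_one in H1.
    apply (Hev p (INR n * - tau) _ _ Hp) in H2. rewrite Hn2 in H2. apply Cmod_near_one in H2.
    rewrite (iter_weighted_comp phi p lambda tau n f _ Hp Hphi) in H2
      by (apply (disk_flow p Hp _ _ disk_0)).
    rewrite (flow_flow p Hp _ _ _ disk_0) in H2.
    replace (INR n * tau + INR n * - tau) with 0 in H2 by ring. rewrite E0 in H2.
    rewrite Cmod_mult, Cmod_pow in H2.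
    apply Rle_trans with (1 := proj1 H1). rewrite pow_inv.
    assert (Hp0 : 0 < Cmod lambda ^ n) by (apply pow_lt; lra).
    apply Rmult_le_reg_l with (Cmod lambda ^ n); [assumption|].
    rewrite <- Rmult_assoc, Rinv_r by lra. lra.
Qed.

(** Mean value bound for z^k on the disk of radius rho. At k = 0 the factor [INR k] makes the value
    of [pred 0] irrelevant. *)
Lemma Cmod_pow_minus_le (a b : C) (rho : R) (k : nat) :
  Cmod a <= rho -> Cmod b <= rho ->
  Cmod (b ^ k - a ^ k)%C <= INR k * rho ^ pred k * Cmod (b - a)%C.
Proof.
  intros Ha Hb. pose proof (Cmod_ge_0 a) as Ha0. induction k as [|k IH].
  - simpl. replace (1 - 1)%C with (RtoC 0) by ring. rewrite Cmod_0. lra.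
  - replace (b ^ S k - a ^ S k)%C with (b * (b ^ k - a ^ k) + (b - a) * a ^ k)%C by (simpl; ring).
    eapply Rle_trans; [apply Cmod_triangle|]. rewrite !Cmod_mult, Cmod_pow.
    simpl pred. rewrite S_INR. pose proof (Cmod_ge_0 (b - a)%C) as H0.
    pose proof (pow_incr _ _ k (conj Ha0 Ha)) as Hk.
    assert (E : INR k * rho ^ pred k * rho = INR k * rho ^ k).
    { destruct k; [simpl; ring|]. simpl. ring. }
    assert (H1 : Cmod b * Cmod (b ^ k - a ^ k)%C <= rho * (INR k * rho ^ pred k * Cmod (b - a)%C)).
    { apply Rmult_le_compat; try apply Cmod_ge_0; assumption. }
    replace ((INR k + 1) * rho ^ k * Cmod (b - a)%C)
      with (rho * (INR k * rho ^ pred k * Cmod (b - a)%C) + Cmod (b - a)%C * rho ^ k).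
    + apply Rplus_le_compat; [assumption|]. now apply Rmult_le_compat_l.
    + replace (rho * (INR k * rho ^ pred k * Cmod (b - a)%C))
        with ((INR k * rho ^ pred k * rho) * Cmod (b - a)%C) by ring. rewrite E. ring.
Qed.

(** The functional has coefficients b^k - a^k. As the weight is at least k + 1, its squared norm is
    at most |b - a|^2 times the sum of k rho^(2(k-1)), which is 1 / (1 - rho^2)^2. Distinctness of a
    and b makes the bound positive, as [functional_bound] requires. *)
Lemma norm_lt_difference nu h d (a b : C) rho :
  1 / 2 <= nu -> norm_lt nu h d -> Cmod a <= rho -> Cmod b <= rho -> rho < 1 -> a <> b ->
  Cmod (h b - h a)%C <= d * (Cmod (b - a)%C / (1 - rho ^ 2)).
Proof.
  intros Hnu [Hd [c [S0 [Hc [HS HSd]]]]] Ha Hb Hrho Hab.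
  pose proof (Cmod_ge_0 a) as Ha0.
  assert (Hba : 0 < Cmod (b - a)%C).
  { apply Cmod_gt_0. intros E. apply Hab. replace b with (b - a + a)%C by ring. rewrite E. ring. }
  assert (Hr2 : 0 <= rho ^ 2 < 1) by (split; nra).
  rewrite has_taylorE in Hc.
  assert (HL : Cseries (fun k => (c k * (b ^ k - a ^ k))%C) (h b - h a)%C).
  { eapply is_series_ext; [|apply (@is_series_minus C_AbsRing C_NormedModule _ _ _ _
      (Hc b ltac:(unfold disk; lra)) (Hc a ltac:(unfold disk; lra)))].
    intros k. change (c k * b ^ k - c k * a ^ k = c k * (b ^ k - a ^ k))%C. ring. }
  refine (functional_bound nu _ _ S0 d _ _ Hd _ HS HSd _ HL); [apply Rdiv_lt_0_compat; lra|].
  assert (Hterm : forall k, Cmod (b ^ k - a ^ k)%C ^ 2 / weight nu k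
     <= Cmod (b - a)%C ^ 2 * (INR k * (rho ^ 2) ^ pred k)).
  { intros k. assert (Hw : INR k + 1 <= weight nu k).
    { unfold weight. rewrite <- (Rpower_1 (INR k + 1)) at 1 by (pose proof (pos_INR k); lra).
      apply Rle_Rpower; pose proof (pos_INR k); lra. }
    pose proof (pos_INR k) as Hk.
    apply Rmult_le_reg_r with (weight nu k); [apply weight_gt0|].
    unfold Rdiv. rewrite Rmult_assoc, Rinv_l, Rmult_1_r
      by (pose proof (weight_gt0 nu k); lra).
    apply Rle_trans with ((INR k * rho ^ pred k * Cmod (b - a)%C) ^ 2).
    - apply pow_incr. split; [apply Cmod_ge_0|now apply Cmod_pow_minus_le].
    - replace ((INR k * rho ^ pred k * Cmod (b - a)%C) ^ 2)
        with (Cmod (b - a)%C ^ 2 * (INR k * (rho ^ 2) ^ pred k) * INR k).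
      + apply Rmult_le_compat_l; [|lra].
        apply Rmult_le_pos; [apply pow2_ge_0|]. apply Rmult_le_pos; [assumption|].
        apply pow_le. lra.
      + rewrite !Rpow_mult_distr, <- !pow_mult, (Nat.mul_comm (pred k) 2). ring. }
  intros n.
  apply Rle_trans with (sum_n (fun k => Cmod (b - a)%C ^ 2 * (INR k * (rho ^ 2) ^ pred k)) n).
  { apply sum_n_m_le. exact Hterm. }
  assert (HG : forall n, sum_n (fun k => Cmod (b - a)%C ^ 2 * (INR k * (rho ^ 2) ^ pred k)) (S n)
     = sum_n (fun k => Cmod (b - a)%C ^ 2 * ((INR k + 1) * (rho ^ 2) ^ k)) n).
  { intros m. induction m as [|m IH].
    - rewrite Rsum_Sn, !sum_O. simpl. ring.
    - rewrite Rsum_Sn, IH, Rsum_Sn, (S_INR (S m)). reflexivity. }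
  assert (HB : forall n, sum_n (fun k => Cmod (b - a)%C ^ 2 * ((INR k + 1) * (rho ^ 2) ^ k)) n
     <= (Cmod (b - a)%C / (1 - rho ^ 2)) ^ 2).
  { intros m. replace ((Cmod (b - a)%C / (1 - rho ^ 2)) ^ 2)
      with (Cmod (b - a)%C ^ 2 * / (1 - rho ^ 2) ^ 2) by (field; lra).
    apply Rsum_le_series.
    - intros k. apply Rmult_le_pos; [apply pow2_ge_0|].
      apply Rmult_le_pos; [pose proof (pos_INR k); lra|apply pow_le; lra].
    - apply Rseries_scal, is_series_geom_derive. assumption. }
  destruct n as [|n].
  - rewrite sum_O. simpl. rewrite Rmult_0_l, Rmult_0_r.
    apply (pow2_ge_0 (Cmod (b - a)%C / (1 - rho ^ 2))).
  - rewrite HG. apply HB.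
Qed.

(** Both base points lie on the radius towards p, where [flow_den] is 1 - i T (1 - x), respectively
    1 - i T at 0, and the increment is exactly x p over the product of the two. The last two bounds
    give a common radius for [norm_lt_difference]. *)
Lemma flow_real_minus_flow_0 p T (x : R) : Cmod p = 1 -> 0 < x < 1 ->
  Cmod (flow p T (x * p) - flow p T 0)%C <= x / ((1 - x) * (1 + T ^ 2)) /\
  flow p T 0 <> flow p T (x * p)%C /\ disk (x * p)%C /\
  Cmod (flow p T 0) ^ 2 <= 1 - (1 - x ^ 2) / (1 + T ^ 2) /\
  Cmod (flow p T (x * p)%C) ^ 2 <= 1 - (1 - x ^ 2) / (1 + T ^ 2).
Proof.
  intros Hp Hx.
  assert (Hmx : Cmod (x * p)%C = x) by (rewrite Cmod_mult, Cmod_R, Rabs_pos_eq, Hp; lra).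
  assert (Hxd : disk (x * p)%C) by (unfold disk; lra).
  pose proof (flow_den_neq0 p Hp T _ Hxd) as Hd1.
  pose proof (flow_den_neq0 p Hp T _ disk_0) as Hd2.
  pose proof (Cmod2_flow p Hp T _ Hxd) as HF1.
  pose proof (Cmod2_flow p Hp T _ disk_0) as HF2.
  pose proof (Cmod2_flow_den_0 p T) as HD2.
  pose proof (pow2_ge_0 T) as HT.
  assert (Eden : flow_den p T (x * p)%C = (1 + Ci * T * (x - 1))%C).
  { unfold flow_den. replace (Cconj p * (x * p))%C with (x * (p * Cconj p))%C by ring.
    rewrite conj_mul_self by assumption. ring. }
  assert (HD1 : Cmod (flow_den p T (x * p)%C) ^ 2 = 1 + (1 - x) ^ 2 * T ^ 2).
  { rewrite Eden, Cmod2_alt. simpl. ring. }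
  set (d1 := flow_den p T (x * p)%C) in *. set (d2 := flow_den p T 0%C) in *.
  assert (Ediff : (flow p T (x * p) - flow p T 0 = x * p / (d1 * d2))%C).
  { unfold flow. fold d1 d2.
    replace (p + (x * p - p) / d1 - (p + (0 - p) / d2))%C
      with (p * ((x - 1) * d2 + d1) / (d1 * d2))%C by (field; split; assumption).
    replace ((x - 1) * d2 + d1)%C with (RtoC x); [f_equal; ring|].
    rewrite Eden. unfold d2, flow_den. ring. }
  pose proof (proj1 (Cmod_gt_0 _) Hd1) as Hd1'. pose proof (proj1 (Cmod_gt_0 _) Hd2) as Hd2'.
  assert (Hprod : (1 - x) * (1 + T ^ 2) <= Cmod d1 * Cmod d2).
  {    assert (((1 - x) * (1 + T ^ 2)) ^ 2 <= (Cmod d1 * Cmod d2) ^ 2).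
    { rewrite !Rpow_mult_distr, HD1, HD2.
      replace ((1 - x) ^ 2 * (1 + T ^ 2) ^ 2) with ((1 - x) ^ 2 * (1 + T ^ 2) * (1 + T ^ 2)) by ring.
      apply Rmult_le_compat_r; [lra|]. nra. }
    apply Rsqr_incr_0_var; [|nra]. unfold Rsqr. simpl in H. lra. }
  assert (Hpos : 0 < (1 - x) * (1 + T ^ 2)) by nra.
  split; [|split; [|split; [assumption|split]]].
  - rewrite Ediff, Cmod_div, Hmx, Cmod_mult.
    + apply Rmult_le_compat_l; [lra|]. now apply Rinv_le_contravar.
    + intros E. pose proof (Cmod_mult d1 d2) as E2. rewrite E, Cmod_0 in E2. nra.
  - intros E. assert (E2 : (x * p / (d1 * d2))%C = 0%C) by (rewrite <- Ediff, E; ring).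
    assert (E3 : (x * p)%C = 0%C).
    { replace (x * p)%C with (x * p / (d1 * d2) * (d1 * d2))%C by (field; split; assumption).
      rewrite E2. ring. }
    rewrite E3, Cmod_0 in Hmx. lra.
  - rewrite Cmod_0, HD2 in HF2.
    assert ((1 - x ^ 2) / (1 + T ^ 2) <= (1 - 0 ^ 2) / (1 + T ^ 2)).
    { apply Rmult_le_compat_r; [apply Rlt_le, Rinv_0_lt_compat; lra|nra]. }
    lra.
  - rewrite Hmx, HD1 in HF1.
    assert ((1 - x ^ 2) / (1 + T ^ 2) <= (1 - x ^ 2) / (1 + (1 - x) ^ 2 * T ^ 2)).
    { apply Rmult_le_compat_l; [nra|]. apply Rinv_le_contravar; nra. }
    lra.
Qed.

(* Near the identity function f(z) = z, the increment of f o flow from 0 to x p is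
   smaller than x by the factor 1 / (1 + T^2), up to the norm of the perturbation. *)
Lemma not_recurrent_of_ge_half (phi : C -> C) (p lambda : C) (tau nu : R) :
  Cmod p = 1 -> tau <> 0 -> (forall z, disk z -> phi z = flow p tau z) ->
  Cmod lambda = 1 -> 1 / 2 <= nu -> ~ recurrent nu (weighted_comp lambda phi).
Proof.
  intros Hp Htau Hphi Hl Hnu Hrec.
  assert (Ht2 : 0 < tau ^ 2) by (assert (0 < tau * tau) by (apply Rsqr_pos_lt; assumption); simpl; lra).
  (* Bounds the contraction 1 / (1 + T^2) uniformly over all return times n >= 1. *)
  set (L := / (1 + tau ^ 2)).
  assert (HL : 0 < L < 1).
  { split; [apply Rinv_0_lt_compat; lra|]. unfold L. rewrite <- Rinv_1 at 2. apply Rinv_lt_contravar; lra. }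
  (* The increment shrinks by at least the factor L / (1 - x), and this x keeps 1 - x above L by (1
     - L) / 2. The choice of d below gives d / (1 - x^2) = (1 - L) / 8, small against that
     margin. *)
  set (x := (1 - L) / 2). assert (Hx : 0 < x < 1) by (unfold x; lra).
  assert (Hx2 : 0 < 1 - x ^ 2) by nra.
  set (d := (1 - L) * (1 - x ^ 2) / 8).
  assert (Hd : 0 < d) by (unfold d; nra).
  assert (Hid : dirichlet nu (fun z => z ^ 1)%C) by apply dirichlet_monomial.
  destruct (recurrent_near _ _ _ d Hrec Hid Hd) as [n [f [Hn [H1 H2]]]].
  set (T := INR n * tau). pose proof (flow_real_minus_flow_0 p T x Hp Hx) as HF.
  destruct HF as [HF1 [HF2 [Hxd [HF3 HF4]]]].
  set (a := flow p T 0) in *. set (b := flow p T (x * p)%C) in *.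
  assert (HT : L >= / (1 + T ^ 2)).
  { apply Rle_ge. unfold L. apply Rinv_le_contravar; [lra|]. unfold T.
    assert (1 <= INR n) by (apply (le_INR 1); lia). rewrite Rpow_mult_distr.
    assert (1 <= INR n ^ 2) by nra. nra. }
  pose proof (pow2_ge_0 T) as HT2.
  set (e := (1 - x ^ 2) / (1 + T ^ 2)) in *.
  assert (He : 0 < e) by (apply Rdiv_lt_0_compat; lra).
  assert (He1 : e < 1).
  { apply Rmult_lt_reg_r with (1 + T ^ 2); [lra|]. unfold e, Rdiv.
    rewrite Rmult_assoc, Rinv_l by lra. nra. }
  set (rho := sqrt (1 - e)).
  assert (Hrho2 : rho ^ 2 = 1 - e) by (apply pow2_sqrt; lra).
  assert (Hrho : rho < 1) by (rewrite <- sqrt_1; apply sqrt_lt_1_alt; lra).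
  assert (Ha : Cmod a <= rho).
  { rewrite <- (sqrt_pow2 (Cmod a)) by apply Cmod_ge_0. now apply sqrt_le_1_alt. }
  assert (Hb : Cmod b <= rho).
  { rewrite <- (sqrt_pow2 (Cmod b)) by apply Cmod_ge_0. now apply sqrt_le_1_alt. }
  pose proof (norm_lt_difference _ _ _ a b rho Hnu H1 Ha Hb Hrho HF2) as D1.
  assert (Hmx : Cmod (x * p)%C = x) by (rewrite Cmod_mult, Cmod_R, Rabs_pos_eq, Hp; lra).
  assert (D2 := norm_lt_difference _ _ _ (RtoC 0) (x * p)%C x Hnu H2).
  rewrite Cmod_0, Hmx in D2. specialize (D2 ltac:(lra) ltac:(lra) ltac:(lra)).
  assert (Hne : RtoC 0 <> (x * p)%C) by (intros E; rewrite <- E, Cmod_0 in Hmx; lra).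
  specialize (D2 Hne).
  rewrite !(iter_weighted_comp phi p lambda tau n f _ Hp Hphi) in D2 by (assumption || apply disk_0).
  fold T a b in D2.
  replace (x * p - 0)%C with (x * p)%C in D2 by ring. rewrite Hmx in D2.
  assert (D3 : Cmod (lambda ^ n * (f b - f a))%C = Cmod (f b - f a)%C).
  { rewrite Cmod_mult, Cmod_pow, Hl, pow1. ring. }
  assert (D4 : x <= Cmod (f b - f a)%C + d * (x / (1 - x ^ 2))).
  { rewrite <- D3, <- Hmx at 1.
    pose proof (Cmod_triangle (lambda ^ n * (f b - f a))%C
      (- (lambda ^ n * f b - (x * p) ^ 1 - (lambda ^ n * f a - 0 ^ 1)))%C) as H.
    rewrite Cmod_opp in H.
    replace (lambda ^ n * (f b - f a) + - (lambda ^ n * f b - (x * p) ^ 1 - (lambda ^ n * f a - 0 ^ 1)))%C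
      with (x * p)%C in H by ring.
    lra. }
  assert (D5 : Cmod (f b - f a)%C <= Cmod (b - a)%C + d * (Cmod (b - a)%C / (1 - rho ^ 2))).
  { pose proof (Cmod_triangle (b - a)%C (f b - b ^ 1 - (f a - a ^ 1))%C) as H.
    replace (b - a + (f b - b ^ 1 - (f a - a ^ 1)))%C with (f b - f a)%C in H by ring. lra. }
  set (y := Cmod (b - a)%C) in *.
  replace (1 - rho ^ 2) with e in D5 by (rewrite Hrho2; ring).
  (* The loss 1 / e grows like 1 + T^2 and is cancelled by the contraction of y. This is why d can
     be fixed before n is known. *)
  assert (D6 : y * (1 + d / e) <= x / (1 - x) * (L + d / (1 - x ^ 2))).
  { apply Rle_trans with (x / ((1 - x) * (1 + T ^ 2)) * (1 + d / e)).
    - apply Rmult_le_compat_r; [|assumption].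
      assert (0 < d / e) by (apply Rdiv_lt_0_compat; lra). lra.
    - replace (x / ((1 - x) * (1 + T ^ 2)) * (1 + d / e))
        with (x / (1 - x) * (/ (1 + T ^ 2) + d / (1 - x ^ 2))) by (unfold e; field; repeat split; lra).
      apply Rmult_le_compat_l; [apply Rdiv_le_0_compat; lra|]. lra. }
  assert (Ed : d / (1 - x ^ 2) = (1 - L) / 8) by (unfold d; field; lra).
  assert (D7 : x * (1 - (1 - L) / 8) <= x / (1 - x) * (L + (1 - L) / 8)).
  { rewrite <- Ed. unfold Rdiv in *. lra. }
  assert (D8 : (1 - x) * (1 - (1 - L) / 8) <= L + (1 - L) / 8).
  { apply Rmult_le_reg_l with (x / (1 - x)); [apply Rdiv_lt_0_compat; lra|].
    replace (x / (1 - x) * ((1 - x) * (1 - (1 - L) / 8))) with (x * (1 - (1 - L) / 8)) by (field; lra).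
    exact D7. }
  unfold x in D8. nra.
Qed.

(** * Sufficiency *)

Section Sufficiency.
Variables (p : C) (nu : R).
Hypothesis Hp : Cmod p = 1.
Hypothesis Hnu : nu < 1 / 2.

(** Decay is asked in both time directions: the backward orbit perturbs the starting point, the
    forward orbit is the error on return. *)
Definition flow_null (f : C -> C) : Prop :=
  dirichlet nu f /\ forall eps, 0 < eps -> exists B, forall T, B <= Rabs T ->
    norm_lt nu (fun z => f (flow p T z)) eps.

Definition null_closure (f : C -> C) : Prop :=
  forall eps, 0 < eps -> exists d, flow_null d /\ norm_lt nu (fun z => f z - d z)%C eps.

Lemma flow_null_plus f g : flow_null f -> flow_null g -> flow_null (fun z => f z + g z)%C.
Proof.
  intros [Df Hf] [Dg Hg]. split.
  - apply dirichletE in Df. apply dirichletE in Dg. destruct Df as [R1 H1]. destruct Dg as [R2 H2].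
    apply (dirichlet_norm_lt _ _ (R1 + R2)). now apply norm_lt_plus.
  - intros eps He. destruct (Hf (eps / 2)) as [B1 HB1]; [lra|].
    destruct (Hg (eps / 2)) as [B2 HB2]; [lra|]. exists (Rmax B1 B2). intros T HT.
    replace eps with (eps / 2 + eps / 2) by field.
    apply (norm_lt_plus nu (fun z => f (flow p T z)) (fun z => g (flow p T z))).
    + apply HB1. eapply Rle_trans; [apply Rmax_l|exact HT].
    + apply HB2. eapply Rle_trans; [apply Rmax_r|exact HT].
Qed.

Lemma norm_lt_scal_eps c f eps : 0 < eps -> norm_lt nu f (eps / (Cmod c + 1)) ->
  norm_lt nu (fun z => c * f z)%C eps.
Proof.
  intros He. apply norm_lt_scal; [assumption|]. pose proof (Cmod_ge_0 c) as Hc.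
  apply Rmult_le_reg_r with (Cmod c + 1); [lra|].
  replace (Cmod c * (eps / (Cmod c + 1)) * (Cmod c + 1)) with (Cmod c * eps) by (field; lra).
  nra.
Qed.

Lemma flow_null_scal c f : flow_null f -> flow_null (fun z => c * f z)%C.
Proof.
  intros [Df Hf]. split.
  - apply dirichletE in Df. destruct Df as [R1 H1].
    apply (dirichlet_norm_lt _ _ (Cmod c * R1 + 1)).
    assert (0 <= Cmod c * R1) by (apply Rmult_le_pos; [apply Cmod_ge_0|apply Rlt_le, H1]).
    apply (norm_lt_scal nu f c R1); lra || assumption.
  - intros eps He. destruct (Hf (eps / (Cmod c + 1))) as [B HB].
    { apply Rdiv_lt_0_compat; [assumption|]. pose proof (Cmod_ge_0 c). lra. }
    exists B. intros T HT. apply (norm_lt_scal_eps c (fun z => f (flow p T z))); auto.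
Qed.

Lemma null_closure_ext f g : (forall z, disk z -> f z = g z) -> null_closure f -> null_closure g.
Proof.
  intros E H eps He. destruct (H eps He) as [d [Hd Hn]]. exists d. split; [assumption|].
  revert Hn. apply norm_lt_ext. intros z Hz. now rewrite E.
Qed.

Lemma null_closure_of_null f : flow_null f -> null_closure f.
Proof.
  intros H eps He. exists f. split; [assumption|]. apply norm_lt_0; [intros; ring|assumption].
Qed.

Lemma null_closure_plus f g :
  null_closure f -> null_closure g -> null_closure (fun z => f z + g z)%C.
Proof.
  intros Hf Hg eps He. destruct (Hf (eps / 2)) as [d1 [Hd1 H1]]; [lra|].
  destruct (Hg (eps / 2)) as [d2 [Hd2 H2]]; [lra|].
  exists (fun z => d1 z + d2 z)%C. split; [now apply flow_null_plus|].
  replace eps with (eps / 2 + eps / 2) by field.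
  eapply norm_lt_ext; [|apply (norm_lt_plus _ _ _ _ _ H1 H2)]. intros z _. simpl. ring.
Qed.

Lemma null_closure_scal c f : null_closure f -> null_closure (fun z => c * f z)%C.
Proof.
  intros Hf eps He. destruct (Hf (eps / (Cmod c + 1))) as [d [Hd H1]].
  { apply Rdiv_lt_0_compat; [assumption|]. pose proof (Cmod_ge_0 c). lra. }
  exists (fun z => c * d z)%C. split; [now apply flow_null_scal|].
  eapply norm_lt_ext; [|apply (norm_lt_scal_eps c _ _ He H1)]. intros z _. simpl. ring.
Qed.

Lemma null_closure_closed f :
  (forall eps, 0 < eps -> exists g, null_closure g /\ norm_lt nu (fun z => f z - g z)%C eps) ->
  null_closure f.
Proof.
  intros H eps He. destruct (H (eps / 2)) as [g [Hg Hfg]]; [lra|].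
  destruct (Hg (eps / 2)) as [d [Hd Hgd]]; [lra|]. exists d. split; [assumption|].
  replace eps with (eps / 2 + eps / 2) by field. now apply norm_lt_minus_trans with g.
Qed.

(** The case k = 0 has an explicit null orbit; the power z^k serves to reach the monomials by
    induction. *)
Definition vanishing_geom (k : nat) (Q z : C) : C := ((1 - Cconj p * z) * mono_geom k Q z)%C.

Lemma vanishing_geomE k Q z :
  vanishing_geom k Q z = (mono_geom k Q z + (- Cconj p) * mono_geom (S k) Q z)%C.
Proof. unfold vanishing_geom, mono_geom. simpl. unfold Cdiv. ring. Qed.

Lemma norm_lt_vanishing_geom k Q rho :
  norm_lt nu (mono_geom k Q) rho -> norm_lt nu (mono_geom (S k) Q) rho ->
  norm_lt nu (vanishing_geom k Q) (rho + rho).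
Proof.
  intros H1 H2. eapply norm_lt_ext.
  - intros z _. symmetry. apply vanishing_geomE.
  - apply norm_lt_plus; [exact H1|]. apply (norm_lt_scal nu _ _ rho); [apply H2| |exact H2].
    rewrite Cmod_opp, Cmod_conj, Hp. lra.
Qed.

Lemma dirichlet_mono_geom k Q : Cmod Q < 1 -> exists rho, norm_lt nu (mono_geom k Q) rho.
Proof.
  intros HQ. destruct (norm_lt_mono_geom nu 1 Hnu Rlt_0_1) as [K [HK H]].
  set (X := 1 * (INR k + 1) / (1 - Cmod Q ^ 2) ^ 2 + K / (1 - Cmod Q ^ 2)).
  assert (HX : 0 <= X).
  { apply Cmod_lt1_sq in HQ. pose proof (pos_INR k).
    apply Rplus_le_le_0_compat; apply Rdiv_le_0_compat; try lra; apply pow_lt; lra. }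
  exists (X + 1). apply H; [assumption|lra|]. fold X. nra.
Qed.

Section FlowOfGeom.
Variables (Q : C) (T : R).
Hypothesis HQ : Cmod Q < 1.
(** With u = conj p z one has 1 - Q z = 1 - q u, and composing with the flow turns it into m (1 - q'
    u) / [flow_den]. So q' is the moved parameter and m the multiplier. *)
Let q := (Q * p)%C.
Let m := (1 - Ci * T * (1 - q))%C.
Let q' := ((q - Ci * T * (1 - q)) / m)%C.

Lemma Cmod_Qp : Cmod q = Cmod Q.
Proof. unfold q. rewrite Cmod_mult, Hp. ring. Qed.

(** Counterpart of [Cmod2_flow] for the parameter: q' approaches the unit circle at the rate 1 /
    |m|^2. *)
Lemma Cmod2_flow_multiplier : 0 < Cmod m ^ 2 /\
  1 - Cmod q' ^ 2 = (1 - Cmod Q ^ 2) / Cmod m ^ 2.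
Proof.
  assert (E : Cmod m ^ 2 - Cmod (q - Ci * T * (1 - q))%C ^ 2 = 1 - Cmod Q ^ 2).
  { rewrite <- Cmod_Qp. unfold m. rewrite !Cmod2_alt. destruct q as [x y]. simpl. ring. }
  assert (Hm : 0 < Cmod m ^ 2).
  { pose proof (pow2_ge_0 (Cmod (q - Ci * T * (1 - q))%C)). apply Cmod_lt1_sq in HQ. lra. }
  split; [assumption|]. rewrite <- E. unfold q'. rewrite Cmod_div by now apply Cmod_sq_neq0.
  field. intros E0. rewrite E0 in Hm. lra.
Qed.

(** The factor 1 - conj p z is also divided by [flow_den], so the denominators cancel and (1 - u) /
    (m (1 - q' u)) remains. Splitting off the value 1/m at 0 leaves a coefficient of order 1 / m^2,
    which offsets the growth |m|^4 of the squared norm of [mono_geom 1]. *)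
Lemma vanishing_geom_flow z : disk z ->
  vanishing_geom 0 Q (flow p T z) =
  (/ m * 1 + (- ((1 - q) * Cconj p / (m * m))) * mono_geom 1 (q' * Cconj p) z)%C.
Proof.
  intros Hz. destruct Cmod2_flow_multiplier as [Hm2 Eq'].
  assert (Hm : m <> 0%C) by now apply Cmod_sq_neq0.
  pose proof (flow_den_neq0 p Hp T z Hz) as Hd.
  pose proof (conj_flow p Hp T z Hz) as Eu.
  assert (HQf : (1 - Q * flow p T z)%C <> 0%C).
  { apply one_minus_neq_0, Cmod_mult_lt1; [assumption|]. now apply disk_flow. }
  set (u := (Cconj p * z)%C) in *.
  assert (EQ : (Q * flow p T z = q * (1 + (u - 1) / flow_den p T z))%C).
  { unfold q. replace (Q * flow p T z)%C with (Q * (p * Cconj p) * flow p T z)%C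
      by (rewrite conj_mul_self by assumption; ring).
    replace (Q * (p * Cconj p) * flow p T z)%C
      with (Q * p * (1 + (Cconj p * flow p T z - 1)))%C by ring.
    rewrite Eu. reflexivity. }
  assert (Hqz : (1 - q' * Cconj p * z)%C <> 0%C).
  { apply one_minus_neq_0. apply Cmod_mult_lt1; [|assumption].
    rewrite Cmod_mult, Cmod_conj, Hp, Rmult_1_r. apply Cmod_lt1_sq.
    assert (0 < (1 - Cmod Q ^ 2) / Cmod m ^ 2).
    { apply Rdiv_lt_0_compat; [|assumption]. apply Cmod_lt1_sq in HQ. lra. }
    lra. }
  assert (Hqz' : (m - (q - Ci * T * (1 - q)) * u)%C <> 0%C).
  { intros E. apply Hqz. unfold u in E.
    replace (1 - q' * Cconj p * z)%C with ((m - (q - Ci * T * (1 - q)) * (Cconj p * z)) / m)%C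
      by (unfold q'; field; assumption).
    rewrite E. field. assumption. }
  unfold vanishing_geom, mono_geom. rewrite EQ in *.
  replace (1 - Cconj p * flow p T z)%C with (- (Cconj p * flow p T z - 1))%C by ring. rewrite Eu.
  replace (1 - q' * Cconj p * z)%C with ((m - (q - Ci * T * (1 - q)) * u) / m)%C
    by (unfold q', u; field; assumption).
  replace (1 - q * (1 + (u - 1) / flow_den p T z))%C
    with ((m - (q - Ci * T * (1 - q)) * u) / flow_den p T z)%C.
  - replace (- ((1 - q) * Cconj p / (m * m)) * (z ^ 1 / ((m - (q - Ci * T * (1 - q)) * u) / m)))%C
      with (- ((1 - q) * u / (m * (m - (q - Ci * T * (1 - q)) * u))))%C
      by (unfold u; field; repeat split; assumption).
    replace (- ((u - 1) / flow_den p T z) * ((flow p T z) ^ 0 / ((m - (q - Ci * T * (1 - q)) * u) / flow_den p T z)))%C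
      with ((1 - u) / (m - (q - Ci * T * (1 - q)) * u))%C
      by (simpl; field; repeat split; assumption).
    set (W := (m - (q - Ci * T * (1 - q)) * u)%C) in *.
    replace ((1 - u) / W)%C with (m * (1 - u) / (m * W))%C by (field; split; assumption).
    replace (/ m * 1 + - ((1 - q) * u / (m * W)))%C with ((W - (1 - q) * u) / (m * W))%C
      by (field; split; assumption).
    f_equal. unfold W, m. ring.
  - unfold flow_den in *. fold u in Hd |- *. unfold m. field. assumption.
Qed.

End FlowOfGeom.

Lemma flow_null_vanishing_geom Q : Cmod Q < 1 -> flow_null (vanishing_geom 0 Q).
Proof.
  intros HQ. split.
  { destruct (dirichlet_mono_geom 0 Q HQ) as [R1 H1]. destruct (dirichlet_mono_geom 1 Q HQ) as [R2 H2].
    apply (dirichlet_norm_lt _ _ (Rmax R1 R2 + Rmax R1 R2)).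
    apply norm_lt_vanishing_geom; [apply (norm_lt_weaken _ _ R1)|apply (norm_lt_weaken _ _ R2)];
      try assumption; [apply Rmax_l|apply Rmax_r]. }
  intros eps He.
  set (q := (Q * p)%C). set (y := 1 - Cmod Q ^ 2).
  assert (Hy : 0 < y) by (unfold y; apply Cmod_lt1_sq in HQ; lra).
  assert (Hq1 : 0 < Cmod (1 - q)%C).
  { apply Cmod_gt_0, one_minus_neq_0. unfold q. rewrite Cmod_mult, Hp. lra. }
  set (s := Cmod (1 - q)%C) in *.
  destruct (proj1 (dirichletE _ _) (dirichlet_1 nu)) as [R1 HR1].
  pose proof (proj1 HR1) as HR1pos.
  (* After the cancellation the leading part of the squared norm is 2 eta s^2 / y^2, here eps^2 / 8:
     half of the allowance (eps / 2)^2 for the nonconstant term. *)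
  set (eta := eps ^ 2 * y ^ 2 / (16 * s ^ 2)).
  assert (Hs2 : 0 < s ^ 2) by nra. assert (Hy2 : 0 < y ^ 2) by nra. assert (He2 : 0 < eps ^ 2) by nra.
  assert (Heta : 0 < eta) by (apply Rdiv_lt_0_compat; nra).
  destruct (norm_lt_mono_geom nu eta Hnu Heta) as [K [HK HM]].
  (* Lower bound wanted for |m|: the second summand controls the constant 1/m, the third the
     remainder K s^2 / (y |m|^2), and the 1 gives |m|^2 >= |m|. *)
  set (X := 1 + 2 * R1 / eps + 8 * K * s ^ 2 / (y * eps ^ 2)).
  assert (HX1 : 0 <= 2 * R1 / eps) by (apply Rdiv_le_0_compat; lra).
  assert (HX2 : 0 <= 8 * K * s ^ 2 / (y * eps ^ 2)) by (apply Rdiv_le_0_compat; nra).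
  assert (HX : 1 <= X /\ 2 * R1 / eps <= X /\ 8 * K * s ^ 2 / (y * eps ^ 2) < X)
    by (unfold X; lra).
  (* From |m| >= |T| s - 1. *)
  clearbody X. exists ((X + 1) / s). intros T HT.
  set (m := (1 - Ci * T * (1 - q))%C). set (q' := ((q - Ci * T * (1 - q)) / m)%C).
  destruct (Cmod2_flow_multiplier Q T HQ) as [Hm2 Eq']. fold q m q' y in Hm2, Eq'.
  assert (HmX : X <= Cmod m).
  { assert (X + 1 <= Rabs T * s).
    { apply (Rmult_le_compat_r s) in HT; [|lra].
      replace ((X + 1) / s * s) with (X + 1) in HT by (field; lra). exact HT. }
    pose proof (Cmod_triangle (- m) 1) as H1. rewrite Cmod_opp, Cmod_1 in H1.
    replace (- m + 1)%C with (Ci * T * (1 - q))%C in H1 by (unfold m; ring).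
    rewrite !Cmod_mult, Cmod_Ci, Cmod_R in H1. fold s in H1. lra. }
  assert (Hm0 : 0 < Cmod m) by lra.
  assert (Hm : m <> 0%C) by now apply Cmod_gt_0.
  set (M := Cmod m ^ 2) in *.
  assert (HMX : X <= M) by (unfold M; nra).
  apply norm_lt_ext with (fun z => / m * 1 + (- ((1 - q) * Cconj p / (m * m))) * mono_geom 1 (q' * Cconj p) z)%C.
  { intros z Hz. symmetry. now apply vanishing_geom_flow. }
  replace eps with (eps / 2 + eps / 2) by field.
  apply norm_lt_plus.
  - apply (norm_lt_scal nu (fun _ => RtoC 1) _ R1); [lra| |assumption].
    rewrite Cmod_inv by assumption.
    apply Rmult_le_reg_l with (Cmod m); [assumption|].
    rewrite <- Rmult_assoc, Rinv_r, Rmult_1_l by lra.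
    replace R1 with (2 * R1 / eps * (eps / 2)) by (field; lra).
    apply Rmult_le_compat_r; lra.
  - apply (norm_lt_scal nu _ _ (eps * M / (2 * s))); [lra| |].
    + rewrite Cmod_opp, Cmod_div, !Cmod_mult, Cmod_conj, Hp.
      * fold s. right. unfold M. field. split; lra.
      * intros E. pose proof (Cmod_mult m m) as E2. rewrite E, Cmod_0 in E2. nra.
    + assert (EM : Cmod (q' * Cconj p)%C ^ 2 = 1 - y / M).
      { rewrite Cmod_mult, Cmod_conj, Hp, Rmult_1_r. lra. }
      assert (HyM : 0 < y / M) by (apply Rdiv_lt_0_compat; lra).
      apply HM.
      * apply Cmod_lt1_sq. lra.
      * apply Rdiv_lt_0_compat; nra.
      * rewrite EM. replace (1 - (1 - y / M)) with (y / M) by ring. simpl (INR 1).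
        replace (eta * (1 + 1) / (y / M) ^ 2 + K / (y / M)) with
          (eps ^ 2 * M ^ 2 / (8 * s ^ 2) + K * M / y) by (unfold eta; field; lra).
        replace ((eps * M / (2 * s)) ^ 2) with
          (eps ^ 2 * M ^ 2 / (8 * s ^ 2) + (eps ^ 2 * M / (8 * s ^ 2)) * M) by (field; lra).
        apply Rplus_lt_compat_l.
        replace (K * M / y) with ((eps ^ 2 * M / (8 * s ^ 2)) * (8 * K * s ^ 2 / (y * eps ^ 2)))
          by (field; lra).
        apply Rmult_lt_compat_l; [|lra]. apply Rdiv_lt_0_compat; nra.
Qed.

(** For nonzero Q, the difference quotient in the parameter between Q and 0 raises k by one, hence
    an induction over all Q at once. The value Q = 0 is then recovered as the limit of small real
    parameters r. *)
Lemma null_closure_vanishing_geom k : forall Q, Cmod Q < 1 -> null_closure (vanishing_geom k Q).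
Proof.
  assert (C0 : Cmod 0 < 1) by (rewrite Cmod_0; lra).
  induction k as [|k IH]; intros Q HQ.
  { now apply null_closure_of_null, flow_null_vanishing_geom. }
  assert (Hnz : forall Q, Cmod Q < 1 -> Q <> 0%C -> null_closure (vanishing_geom (S k) Q)).
  { clear Q HQ. intros Q HQ HQ0.
    apply null_closure_ext with
      (fun z => / Q * (vanishing_geom k Q z + - (1) * vanishing_geom k 0 z))%C.
    - intros z Hz. pose proof (one_minus_neq_0 _ (Cmod_mult_lt1 Q z HQ Hz)) as H1.
      unfold vanishing_geom, mono_geom. simpl. field. split; assumption.
    - apply null_closure_scal, null_closure_plus; [now apply IH|].
      now apply null_closure_scal, IH. }
  destruct (Ceq_dec Q 0) as [->|HQ0]; [|now apply Hnz].
  apply null_closure_closed. intros eps He.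
  destruct (norm_lt_mono_geom nu 1 Hnu Rlt_0_1) as [K [HK HM]].
  (* Uniform norm bound for [mono_geom j r] with j <= k + 3 and r <= 1/2, where 1 - r^2 >= 1/2; the
     final 1 ensures R0 <= R0^2. *)
  set (R0 := 4 * (INR k + 4) + 2 * K + 1). pose proof (pos_INR k) as Hk.
  assert (HR0 : 1 <= R0) by (unfold R0; lra).
  set (r := Rmin (1 / 2) (eps / (2 * R0))).
  assert (Hr : 0 < r) by (apply Rmin_glb_lt; [lra|apply Rdiv_lt_0_compat; lra]).
  assert (Hr1 : r <= 1 / 2) by apply Rmin_l.
  assert (Hr2 : r * (R0 + R0) <= eps).
  { replace eps with (eps / (2 * R0) * (R0 + R0)) by (field; lra).
    apply Rmult_le_compat_r; [lra|apply Rmin_r]. }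
  assert (HCr : Cmod r = r) by (rewrite Cmod_R, Rabs_pos_eq; lra).
  assert (Hr0 : RtoC r <> 0%C) by (intros E; apply RtoC_inj in E; lra).
  exists (vanishing_geom (S k) r). split; [apply Hnz; [lra|assumption]|].
  apply norm_lt_ext with (fun z => - r * vanishing_geom (S (S k)) r z)%C.
  { intros z Hz. assert (H1 : (1 - r * z)%C <> 0%C).
    { apply one_minus_neq_0, Cmod_mult_lt1; [lra|assumption]. }
    unfold vanishing_geom, mono_geom. simpl. field. assumption. }
  apply (norm_lt_scal nu _ _ (R0 + R0)); [assumption|rewrite Cmod_opp, HCr; assumption|].
  assert (HG : forall j, INR j <= INR k + 3 -> norm_lt nu (mono_geom j r) R0).
  { intros j Hj. apply HM; [lra|lra|]. rewrite HCr.
    assert (H1 : 1 / 2 <= 1 - r ^ 2) by nra. pose proof (pos_INR j).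
    apply Rle_lt_trans with (4 * (INR k + 4) + 2 * K); [|unfold R0 in *; nra].
    apply Rplus_le_compat.
    - apply Rmult_le_reg_r with ((1 - r ^ 2) ^ 2); [nra|]. unfold Rdiv.
      rewrite Rmult_assoc, Rinv_l by nra.
      assert (1 / 4 <= (1 - r ^ 2) ^ 2) by nra. nra.
    - apply Rmult_le_reg_r with (1 - r ^ 2); [nra|]. unfold Rdiv.
      rewrite Rmult_assoc, Rinv_l by nra. nra. }
  apply norm_lt_vanishing_geom; apply HG; rewrite !S_INR; lra.
Qed.

(* z^k is the limit of [vanishing_geom k (r * conj p)] as r -> 1, because nu < 1/2. *)
Lemma null_closure_monomial k : null_closure (fun z => z ^ k)%C.
Proof.
  apply null_closure_closed. intros eps He. pose proof (pos_INR k) as Hk.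
  assert (He2 : 0 < eps ^ 2) by nra.
  set (eta := eps ^ 2 / (4 * (INR k + 2))).
  assert (Heta : 0 < eta) by (apply Rdiv_lt_0_compat; lra).
  destruct (norm_lt_mono_geom nu eta Hnu Heta) as [K [HK HM]].
  (* The error is t times [mono_geom (S k) Q] up to a unimodular factor. After multiplication by
     t^2, [eta] holds the leading part of the squared norm to eps^2 / 4 and t holds the K part to
     eps^2 / 4. *)
  set (t := Rmin (1 / 2) (eps ^ 2 / (4 * (K + 1)))).
  assert (Ht : 0 < t) by (apply Rmin_glb_lt; [lra|apply Rdiv_lt_0_compat; lra]).
  assert (Ht1 : t <= 1 / 2) by apply Rmin_l.
  assert (Ht2 : t * K <= eps ^ 2 / 4).
  { apply Rle_trans with (eps ^ 2 / (4 * (K + 1)) * (K + 1)).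
    - apply Rmult_le_compat; try lra. apply Rmin_r.
    - right. field. lra. }
  set (r := 1 - t).
  set (Q := (r * Cconj p)%C).
  assert (HCQ : Cmod Q = r).
  { unfold Q. rewrite Cmod_mult, Cmod_conj, Hp, Cmod_R, Rabs_pos_eq; unfold r; lra. }
  assert (HQ : Cmod Q < 1) by (unfold r in HCQ; lra).
  exists (vanishing_geom k Q). split; [now apply null_closure_vanishing_geom|].
  apply norm_lt_ext with (fun z => (RtoC t * Cconj p) * mono_geom (S k) Q z)%C.
  { intros z Hz. pose proof (one_minus_neq_0 _ (Cmod_mult_lt1 Q z HQ Hz)) as H1.
    unfold vanishing_geom, mono_geom. simpl. unfold Q, r in *. rewrite RtoC_minus in *.
    field. assumption. }
  apply (norm_lt_scal nu _ _ (eps / t)); [assumption| |].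
  { rewrite Cmod_mult, Cmod_conj, Hp, Cmod_R, Rabs_pos_eq by lra. right. field. lra. }
  apply HM; [assumption|now apply Rdiv_lt_0_compat|].
  rewrite HCQ, S_INR. set (w := 1 - r ^ 2).
  assert (Hw : t <= w) by (unfold w, r; nra).
  assert (Hinv : / w <= / t) by (apply Rinv_le_contravar; lra).
  assert (Hinv0 : 0 < / w) by (apply Rinv_0_lt_compat; lra).
  assert (H1 : eta * (INR k + 1 + 1) / w ^ 2 <= eps ^ 2 / 4 * (/ t) ^ 2).
  { replace (eta * (INR k + 1 + 1) / w ^ 2) with (eps ^ 2 / 4 * (/ w) ^ 2) by (unfold eta; field; lra).
    apply Rmult_le_compat_l; [lra|]. apply pow_incr. lra. }
  assert (H2 : K / w <= eps ^ 2 / 4 * (/ t) ^ 2).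
  { apply Rle_trans with (K * / t); [apply Rmult_le_compat_l; lra|].
    replace (K * / t) with (t * K * (/ t) ^ 2) by (field; lra).
    apply Rmult_le_compat_r; [apply pow2_ge_0|assumption]. }
  replace ((eps / t) ^ 2) with (eps ^ 2 * (/ t) ^ 2) by (field; lra).
  assert (0 < (/ t) ^ 2) by (apply pow_lt, Rinv_0_lt_compat; assumption). nra.
Qed.

(** Removing one monomial at a time keeps a function g for the tail at every stage and places f - g,
    a polynomial, in the closed subspace. *)
Lemma taylor_tail f a N : has_taylor f a ->
  exists g b, has_taylor g b /\ null_closure (fun z => f z - g z)%C /\
    (forall k, (k < N)%nat -> b k = RtoC 0) /\ (forall k, (N <= k)%nat -> b k = a k).
Proof.
  intros Ha. induction N as [|N [g [b [Hg [Hfg [Hb0 Hb1]]]]]].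
  - exists f, a. split; [assumption|]. split; [|split; [intros; lia|reflexivity]].
    apply null_closure_of_null. split.
    + apply (dirichlet_norm_lt _ _ 1). apply norm_lt_0; [intros; ring|lra].
    + intros eps He. exists 0. intros T _. apply norm_lt_0; [intros; ring|assumption].
  - set (e := @PS_incr_n C_AbsRing C_NormedModule (fun j => (RtoC 0 ^ j)%C) N).
    assert (He : forall k, e k = if Nat.eq_dec k N then RtoC 1 else RtoC 0).
    { intros k. unfold e. rewrite PS_incr_n_simplify.
      destruct (Compare_dec.le_lt_dec N k); destruct (Nat.eq_dec k N); try lia; try reflexivity.
      - subst k. now rewrite Nat.sub_diag.
      - destruct (k - N)%nat eqn:E; [lia|]. simpl. ring. }
    exists (fun z => g z + (- a N) * z ^ N)%C, (fun k => b k + (- a N) * e k)%C.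
    split; [|split; [|split]].
    + apply (has_taylor_plus g (fun z => - a N * z ^ N)%C); [assumption|].
      apply (has_taylor_scal (fun z => z ^ N)%C).
      apply (has_taylor_ext (mono_geom N 0)).
      * intros z _. unfold mono_geom. rewrite Cmult_0_l. field.
      * apply has_taylor_mono_geom. rewrite Cmod_0. lra.
    + apply null_closure_ext with (fun z => (f z - g z) + a N * z ^ N)%C; [intros; ring|].
      apply null_closure_plus; [assumption|]. apply null_closure_scal, null_closure_monomial.
    + intros k Hk. rewrite He. destruct (Nat.eq_dec k N) as [->|].
      * rewrite Hb1 by lia. ring.
      * rewrite Hb0 by lia. ring.
    + intros k Hk. rewrite He. destruct (Nat.eq_dec k N) as [->|]; [lia|].
      rewrite Hb1 by lia. ring.
Qed.

Lemma null_closure_dirichlet f : dirichlet nu f -> null_closure f.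
Proof.
  intros Hf. apply dirichletE in Hf. destruct Hf as [R0 [_ [a [S0 [Ha [HS _]]]]]].
  apply null_closure_closed. intros eps He.
  set (u := fun k => Cmod (a k) ^ 2 * weight nu k).
  assert (He2 : 0 < eps ^ 2) by nra.
  assert (HL : is_lim_seq (sum_n u) S0) by exact HS.
  apply is_lim_seq_spec in HL. destruct (HL (mkposreal _ He2)) as [N HN].
  specialize (HN N (Nat.le_refl N)). simpl in HN.
  (* [S N], because [sum_n u N] includes the index N; the squared norm of the tail is then exactly
     [S0 - sum_n u N]. *)
  destruct (taylor_tail f a (S N) Ha) as [g [b [Hg [Hfg [Hb0 Hb1]]]]].
  exists (fun z => f z - g z)%C. split; [assumption|].
  apply norm_lt_ext with g; [intros; ring|]. split; [assumption|].
  exists b, (S0 - sum_n u N). split; [assumption|]. split.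
  - apply (is_series_shift _ (S N)).
    + intros j Hj. rewrite Hb0 by assumption. rewrite Cmod_0. ring.
    + apply is_series_ext with (fun j => u (S N + j)%nat).
      { intros j. unfold u. rewrite Hb1 by lia. reflexivity. }
      apply is_series_incr_n; [lia|]. simpl pred.
      assert (E : S0 = plus (S0 - sum_n u N) (sum_n u N)).
      { change (S0 = S0 - sum_n u N + sum_n u N). ring. }
      exact (eq_rect _ (fun l => is_series _ l) HS _ E).
  - apply Rle_lt_trans with (Rabs (sum_n u N - S0)); [|exact HN].
    rewrite Rabs_minus_sym. apply Rle_abs.
Qed.

(** The order of choices matters: d in U by density, then a ball of radius e1 around d inside U, and
    only then n, large enough for both orbits of d to be below e1. Since |lambda| = 1, the powers of
    lambda do not change these bounds. *)
Lemma recurrent_of_lt_half (phi : C -> C) (lambda : C) (tau : R) :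
  tau <> 0 -> (forall z, disk z -> phi z = flow p tau z) -> Cmod lambda = 1 ->
  recurrent nu (weighted_comp lambda phi).
Proof.
  intros Htau Hphi Hl U [HUd HUo] [f0 Hf0].
  destruct (HUo f0 Hf0) as [e0 [He0 Hball0]].
  destruct (null_closure_dirichlet f0 (HUd f0 Hf0) e0 He0) as [d [[Hdd Hdn] Hd]].
  apply norm_lt_opp, norm_ltE in Hd. destruct Hd as [r0 [Hr0 Hr0e]].
  pose proof (Hball0 d r0 Hdd Hr0 Hr0e) as HUd0.
  destruct (HUo d HUd0) as [e1 [He1 Hball1]].
  destruct (Hdn e1 He1) as [B HB].
  pose proof (Rabs_pos_lt tau Htau) as Ht.
  (* The maximum with 0 secures n > 0 when B is negative. *)
  destruct (INR_unbounded (Rmax 0 (B / Rabs tau))) as [n Hn].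
  assert (Hn0 : 0 < INR n) by (eapply Rle_lt_trans; [apply Rmax_l|exact Hn]).
  assert (HnB : B <= INR n * Rabs tau).
  { assert (B / Rabs tau <= INR n) by (eapply Rle_trans; [apply Rmax_r|apply Rlt_le, Hn]).
    apply (Rmult_le_compat_r (Rabs tau)) in H; [|lra].
    replace (B / Rabs tau * Rabs tau) with B in H by (field; lra). exact H. }
  assert (HB1 : B <= Rabs (INR n * tau)) by (rewrite Rabs_mult, (Rabs_pos_eq (INR n)); lra).
  assert (HB2 : B <= Rabs (- (INR n * tau))) by now rewrite Rabs_Ropp.
  pose proof (HB _ HB1) as Hfor. pose proof (HB _ HB2) as Hback.
  assert (Hln : Cmod (lambda ^ n) = 1) by (rewrite Cmod_pow, Hl, pow1; reflexivity).
  assert (Hln0 : (lambda ^ n)%C <> 0%C) by (apply Cmod_gt_0; lra).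
  assert (Hln' : Cmod (/ lambda ^ n)%C = 1) by (rewrite Cmod_inv, Hln by assumption; field).
  assert (HU : forall g, norm_lt nu (fun z => g z - d z)%C e1 -> U g).
  { intros g Hg. apply norm_ltE in Hg as Hg'. destruct Hg' as [r [Hr Hre]].
    apply (Hball1 g r); try assumption.
    apply dirichletE in Hdd. destruct Hdd as [R1 HR1].
    apply (dirichlet_norm_lt _ _ (e1 + R1)).
    eapply norm_lt_ext; [|apply (norm_lt_plus _ _ _ _ _ Hg HR1)]. intros z _. simpl. ring. }
  assert (Hscal : forall c h, Cmod c = 1 -> norm_lt nu h e1 -> norm_lt nu (fun z => c * h z)%C e1).
  { intros c h Hc. apply norm_lt_scal; [assumption|]. rewrite Hc. lra. }
  exists n. split; [apply INR_lt; exact Hn0|].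
  exists (fun z => d z + / lambda ^ n * d (flow p (- (INR n * tau)) z))%C. split; apply HU.
  - apply (norm_lt_ext nu (fun z => / lambda ^ n * d (flow p (- (INR n * tau)) z))%C); [intros; ring|].
    now apply (Hscal _ (fun z => d (flow p (- (INR n * tau)) z))).
  - apply (norm_lt_ext nu (fun z => lambda ^ n * d (flow p (INR n * tau) z))%C);
      [|now apply (Hscal _ (fun z => d (flow p (INR n * tau) z)))].
    intros z Hz. rewrite (iter_weighted_comp phi p lambda tau) by assumption.
    rewrite flow_flow by assumption. replace (- (INR n * tau) + INR n * tau) with 0 by ring.
    rewrite flow_0. field. assumption.
Qed.

End Sufficiency.

Theorem theorem3p5 (phi : C -> C) (nu : R) (lambda : C)
    (hphi : parabolic_automorphism phi) :
  recurrent nu (weighted_comp lambda phi) <-> (nu < 1 / 2 /\ Cmod lambda = 1).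
Proof.
  destruct (parabolic_automorphism_flow phi hphi) as [p [tau [Hp [Htau Hphi]]]].
  split.
  - intros Hrec. assert (Hl : Cmod lambda = 1).
    { apply (recurrent_Cmod_lambda phi p lambda tau nu); assumption. }
    split; [|assumption]. apply Rnot_le_lt. intros Hnu.
    now apply (not_recurrent_of_ge_half phi p lambda tau nu).
  - intros [Hnu Hl]. now apply (recurrent_of_lt_half p nu Hp Hnu phi lambda tau).
Qed.
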